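(* Let $N_t,N_r,L\ge 1$ be integers, $N_0>0$, $P>0$, and let $\mu_1,\dots,\mu_L\ge 0$ with $\sum_{l=1}^L\mu_l=L$. Let $\mathbf{H}_1,\dots,\mathbf{H}_L$ be mutually independent random $N_r\times N_t$ complex matrices with $E[\mathrm{tr}(\mathbf{H}_l\mathbf{H}_l^H)]<\infty$. For matrices $\mathbf{F}_1,\dots,\mathbf{F}_L\in\mathbb{C}^{N_t\times N_t}$ and invertible $\mathbf{P}_1,\dots,\mathbf{P}_L\in\mathbb{C}^{N_t\times N_t}$, put $\boldsymbol{\Sigma}_l=\mathbf{P}_l\mathbf{P}_l^H$ and let the weighted sum-rate $R_{\rm sum}^{\rm w}=\sum_{l=1}^L\mu_l R_l$ be as defined in the context. Consider maximizing $R_{\rm sum}^{\rm w}$ over $(\mathbf{F}_l,\mathbf{P}_l)_{l=1}^L$ subject to $\sum_{l=1}^L\mathrm{tr}(\mathbf{P}_l\mathbf{P}_l^H)\le P$. Then an optimal design satisfies, for some real $\theta$, the following conditions: (i) for $l=1,\dots,L$: $-\mu_l\log_2 e\; E_{\mathbf{H}_l}\big[\boldsymbol{\Sigma}_{\mathbf{u}_l|\mathbf{y}_l,\mathbf{H}_l}(\mathbf{H}_l)^{-1}(\mathbf{F}_l-\mathbf{T}_l(\mathbf{H}_l))\boldsymbol{\Sigma}_{S,l}\big]=\mathbf{0}$; (ii) $\boldsymbol{\Sigma}_l=\mathbf{P}_l\mathbf{P}_l^H$ for $l=1,\dots,L$; (iii) for $t=1,\dots,L$: $$\mu_t\log_2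 e\,(\mathbf{P}_t^H)^{-1}-\log_2 e\Big[\sum_{l=1}^{t-1}\mu_l E_{\mathbf{H}_l}[\mathbf{G}_{1,l}(\mathbf{H}_l)]+\mu_t E_{\mathbf{H}_t}[\mathbf{G}_{2,t}(\mathbf{H}_t)]+\sum_{l=t+1}^{L}\mu_l E_{\mathbf{H}_l}[\mathbf{G}_{3,l}(\mathbf{H}_l)]\Big]\mathbf{P}_t=\theta\mathbf{P}_t;$$ (iv) $\theta\big(\sum_{l=1}^L\mathrm{tr}(\mathbf{P}_l\mathbf{P}_l^H)-P\big)=0$; (v) $\sum_{l=1}^L\mathrm{tr}(\mathbf{P}_l\mathbf{P}_l^H)-P\le 0$; (vi) $\theta\ge 0$. Here, writing $\mathbf{S}_l=\boldsymbol{\Sigma}_{\mathbf{u}_l|\mathbf{y}_l,\mathbf{H}_l}(\mathbf{H}_l)^{-1}$ and $\mathbf{T}_l=\mathbf{T}_l(\mathbf{H}_l)$: $\mathbf{G}_{1,l}(\mathbf{H}_l)=\mathbf{T}_l^H\mathbf{S}_l\mathbf{T}_l$; $\mathbf{G}_{2,t}(\mathbf{H}_t)=\mathbf{S}_t-\mathbf{T}_t^H\mathbf{S}_t+\mathbf{T}_t^H\mathbf{S}_t\mathbf{T}_t-\mathbf{S}_t\mathbf{T}_t$; $\mathbf{G}_{3,l}(\mathbf{H}_l)=\mathbf{F}_l^H\mathbf{S}_l\mathbf{F}_l-\mathbf{T}_l^H\mathbf{S}_l\mathbf{F}_l+\mathbf{T}_l^H\mathbf{S}_l\mathbf{T}_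l-\mathbf{F}_l^H\mathbf{S}_l\mathbf{T}_l$.
   Context: Fading MIMO broadcast channel with $L$ receivers, statistical CSI at the transmitter and linear assignment. For $l=1,\dots,L$ define $\boldsymbol{\Sigma}_{S,l}=\sum_{t=1}^{l-1}\boldsymbol{\Sigma}_t$ (the zero matrix for $l=1$), $\mathbf{A}_l=\mathbf{F}_l\boldsymbol{\Sigma}_{S,l}+\boldsymbol{\Sigma}_l$, $\mathbf{B}_l=\boldsymbol{\Sigma}_{S,l}+\boldsymbol{\Sigma}_l$, $\mathbf{C}_l=\mathbf{F}_l\boldsymbol{\Sigma}_{S,l}\mathbf{F}_l^H+\boldsymbol{\Sigma}_l$, $\boldsymbol{\Sigma}_{Z,l}(\mathbf{H}_l)=\mathbf{H}_l\big(\sum_{t=l+1}^L\boldsymbol{\Sigma}_t\big)\mathbf{H}_l^H+N_0\mathbf{I}_{N_r}$, $\boldsymbol{\Sigma}_{\mathbf{u}_l|\mathbf{y}_l,\mathbf{H}_l}(\mathbf{H}_l)=\mathbf{C}_l-\mathbf{A}_l\mathbf{H}_l^H\big[\mathbf{H}_l\mathbf{B}_l\mathbf{H}_l^H+\boldsymbol{\Sigma}_{Z,l}(\mathbf{H}_l)\big]^{-1}\mathbf{H}_l\mathbf{A}_l^H$, $\mathbf{T}_l(\mathbf{H}_l)=\mathbf{A}_l\mathbf{H}_l^H\big[\mathbf{H}_l\mathbf{B}_l\mathbf{H}_l^H+\boldsymbol{\Sigma}_{Z,l}(\mathbf{H}_l)\big]^{-1}\mathbf{H}_l$. The linear assignment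 achievable rate of receiver $l$ is $R_l=\log_2\det(\boldsymbol{\Sigma}_l)-E\big[\log_2\det\boldsymbol{\Sigma}_{\mathbf{u}_l|\mathbf{y}_l,\mathbf{H}_l}(\mathbf{H}_l)\big]$, and the weighted sum-rate is $R_{\rm sum}^{\rm w}=\sum_{l=1}^L\mu_lR_l$. $E_{\mathbf{H}_l}$ denotes expectation over $\mathbf{H}_l$. *)

(* Defs.v *)
(* mathcomp-analysis (probability, Lebesgue integral) +
   mathcomp-real-closed complex numbers R[i] over R : realType. *)
From HB Require Import structures.
From mathcomp Require Import all_boot all_order all_algebra.
From mathcomp Require Import all_classical all_reals all_analysis.
From mathcomp Require Import complex.

Set Implicit Arguments.
Unset Strict Implicit.
Unset Printing Implicit Defensive.

Import Order.TTheory GRing.Theory Num.Theory.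
Local Open Scope classical_set_scope.
Local Open Scope ring_scope.
Local Open Scope complex_scope.

Section Defs.
Context {R : realType}.
Local Notation C := R[i].

(* conjugate (Hermitian) transpose A^H *)
Definition ctmx (m n : nat) (A : 'M[C]_(m, n)) : 'M[C]_(n, m) :=
  (map_mx (fun z : C => z^*) A)^T.

(* base-2 logarithm on the reals *)
Definition log2 (x : R) : R := ln x / ln 2.

(* log2 det of a (Hermitian, hence real-determinant) matrix *)
Definition log2det (n : nat) (M : 'M[C]_n) : R := log2 (complex.Re (\det M)).

Context {d : measure_display} {T : measurableType d} (Pr : probability T R).

(* expectation of a real random variable *)
Definition Ereal (f : T -> R) : R := \int[Pr]_w f w.

(* entrywise expectation of a complex-matrix-valued random variable *)
Definition Emx (m n : nat) (X : T -> 'M[C]_(m, n)) : 'M[C]_(m, n) :=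
  \matrix_(i, j) ((Ereal (fun w => complex.Re (X w i j))) +i* (Ereal (fun w => complex.Im (X w i j)))).

(* a random complex matrix: real and imaginary parts of all entries measurable *)
Definition random_matrix (m n : nat) (X : T -> 'M[C]_(m, n)) : Prop :=
  forall i j, measurable_fun setT (fun w => complex.Re (X w i j)) /\
              measurable_fun setT (fun w => complex.Im (X w i j)).

(* sigma-algebra generated by a random complex matrix (i.e. by the real and
   imaginary parts of its entries) *)
Definition gen_events (m n : nat) (X : T -> 'M[C]_(m, n)) : set (set T) :=
  [set A | exists i j (B : set R), measurable B /\
      (A = (fun w => complex.Re (X w i j)) @^-1` B \/ A = (fun w => complex.Im (X w i j)) @^-1` B)].

Definition sigma_of (m n : nat) (X : T -> 'M[C]_(m, n)) : set (set T) :=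
  <<s gen_events X >>.

(* mutual independence of the random matrices H_0, ..., H_{L-1} *)
Definition mutually_independent (L m n : nat) (H : 'I_L -> T -> 'M[C]_(m, n)) : Prop :=
  forall A : 'I_L -> set T, (forall l, sigma_of (H l) (A l)) ->
    Pr (\bigcap_(l in [set: 'I_L]) A l) = (\prod_(l < L) Pr (A l))%E.

(* The quantities of the context.  Receivers are indexed l : 'I_L
   (0-based: l stands for receiver l+1). *)
Section Channel.
Variables (L Nt Nr : nat) (N0 : R).
Variables (F Sig : 'I_L -> 'M[C]_Nt).

Definition SigS (l : 'I_L) : 'M[C]_Nt := \sum_(t < L | (t < l)%N) Sig t.
Definition SigI (l : 'I_L) : 'M[C]_Nt := \sum_(t < L | (l < t)%N) Sig t.
Definition Amx (l : 'I_L) : 'M[C]_Nt := F l *m SigS l + Sig l.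
Definition Bmx (l : 'I_L) : 'M[C]_Nt := SigS l + Sig l.
Definition Cmx (l : 'I_L) : 'M[C]_Nt := F l *m SigS l *m ctmx (F l) + Sig l.
Definition SigZ (l : 'I_L) (Hm : 'M[C]_(Nr, Nt)) : 'M[C]_Nr :=
  Hm *m SigI l *m ctmx Hm + (N0%:C)%:M.
Definition Kinv (l : 'I_L) (Hm : 'M[C]_(Nr, Nt)) : 'M[C]_Nr :=
  invmx (Hm *m Bmx l *m ctmx Hm + SigZ l Hm).
Definition SigU (l : 'I_L) (Hm : 'M[C]_(Nr, Nt)) : 'M[C]_Nt :=
  Cmx l - Amx l *m ctmx Hm *m Kinv l Hm *m Hm *m ctmx (Amx l).
Definition Tmx (l : 'I_L) (Hm : 'M[C]_(Nr, Nt)) : 'M[C]_Nt :=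
  Amx l *m ctmx Hm *m Kinv l Hm *m Hm.

Definition G1 (l : 'I_L) (Hm : 'M[C]_(Nr, Nt)) : 'M[C]_Nt :=
  let S := invmx (SigU l Hm) in let Tl := Tmx l Hm in
  ctmx Tl *m S *m Tl.
Definition G2 (l : 'I_L) (Hm : 'M[C]_(Nr, Nt)) : 'M[C]_Nt :=
  let S := invmx (SigU l Hm) in let Tl := Tmx l Hm in
  S - ctmx Tl *m S + ctmx Tl *m S *m Tl - S *m Tl.
Definition G3 (l : 'I_L) (Hm : 'M[C]_(Nr, Nt)) : 'M[C]_Nt :=
  let S := invmx (SigU l Hm) in let Tl := Tmx l Hm in
  ctmx (F l) *m S *m F l - ctmx Tl *m S *m F l + ctmx Tl *m S *m Tl
  - ctmx (F l) *m S *m Tl.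

Variable (H : 'I_L -> T -> 'M[C]_(Nr, Nt)).

(* linear assignment achievable rate of receiver l *)
Definition rate (l : 'I_L) : R :=
  log2det (Sig l) - Ereal (fun w => log2det (SigU l (H l w))).

Definition wsum_rate (mu : 'I_L -> R) : R := \sum_(l < L) mu l * rate l.
End Channel.

(* Sigma_l = P_l P_l^H *)
Definition covs (L Nt : nat) (P : 'I_L -> 'M[C]_Nt) : 'I_L -> 'M[C]_Nt :=
  fun l => P l *m ctmx (P l).

Definition total_power (L Nt : nat) (P : 'I_L -> 'M[C]_Nt) : R :=
  \sum_(l < L) complex.Re (\tr (P l *m ctmx (P l))).

(* feasible design: P_l invertible, power constraint *)
Definition feasible (L Nt : nat) (Pw : R) (P : 'I_L -> 'M[C]_Nt) : Prop :=
  (forall l, P l \in unitmx) /\ total_power P <= Pw.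

(* weighted sum-rate of a design (F, P) *)
Definition WSR (L Nt Nr : nat) (N0 : R) (mu : 'I_L -> R)
  (H : 'I_L -> T -> 'M[C]_(Nr, Nt)) (F P : 'I_L -> 'M[C]_Nt) : R :=
  wsum_rate N0 F (covs P) H mu.

(* (F, P) is an optimal design *)
Definition optimal (L Nt Nr : nat) (N0 Pw : R) (mu : 'I_L -> R)
  (H : 'I_L -> T -> 'M[C]_(Nr, Nt)) (F P : 'I_L -> 'M[C]_Nt) : Prop :=
  feasible Pw P /\
  forall F' P' : 'I_L -> 'M[C]_Nt, feasible Pw P' ->
    WSR N0 mu H F' P' <= WSR N0 mu H F P.

End Defs.

(* Main.v *)
(* Optimality is exploited through a variational lower bound on the perturbed rate, so that
   no differentiation under the expectation is needed.  The conditional covariance SigU of a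
   perturbed design is dominated, in the Loewner order, by the error covariance of the LMMSE
   filter of the unperturbed design, which is an explicit quadratic polynomial in the step s.
   Since ln det is concave,
     ln det SigU(s) <= ln det SigU(0) + Re tr (SigU(0)^-1 (errcov(s) - errcov(0))),
   and the expectation of the right-hand side only involves E[G1], E[G2], E[G3] and quadratic
   remainders.  These are finite because |SigU^-1| <= |P^-1|^2 + |H|^2 / N0 while T is bounded.
   Letting s -> 0+ along feasible directions yields the first-order conditions, and the
   multiplier theta is the coefficient of the projection of the gradient on P. *)
Require Import Defs.
From HB Require Import structures.
From mathcomp Require Import all_boot all_order all_algebra.
From mathcomp Require Import all_classical all_reals all_analysis.
From mathcomp Require Import complex measurable_realfun.
From mathcomp Require Import ring lra.

Set Implicit Arguments.
Unset Strict Implicit.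
Unset Printing Implicit Defensive.

Import Order.TTheory GRing.Theory Num.Theory.
Local Open Scope classical_set_scope.
Local Open Scope ring_scope.
Local Open Scope complex_scope.

(** * Conjugate transpose and positive definite matrices *)

Section ConjugateTranspose.
Context {R : realType}.
Local Notation C := R[i].

(** Only second moments of the channel are available, so the envelope of SigU^-1, of order |H|^2,
    can be integrated once but not squared. A second derivative of ln det SigU contains SigU^-1
    twice, and its direct bound need not be integrable; the tangent inequality contains SigU^-1
    once, between bounded factors. It also points in the useful direction: it bounds the perturbed
    rates from below, while optimality bounds the perturbed weighted sum-rate from above.
    Differentiability of the rates is never asserted. F and P are perturbed separately. F is
    unconstrained, so one well-chosen direction suffices for (i). For P, a determinant expansion
    both keeps P + sD invertible for small s and gives the gain in ln det(P P^H). The delicate point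
    is the power constraint: at full power, a direction tangent to the sphere raises the power to
    second order, so the tangential part of the gradient is reached only as a limit of directions
    tilted inward. *)

Lemma ctmxE m n (A : 'M[C]_(m, n)) i j : ctmx A i j = conjc (A j i).
Proof. by rewrite !mxE. Qed.

Lemma ctmxK m n (A : 'M[C]_(m, n)) : ctmx (ctmx A) = A.
Proof. by apply/matrixP => i j; rewrite !ctmxE conjcK. Qed.

Lemma ctmxM m n p (A : 'M[C]_(m, n)) (B : 'M[C]_(n, p)) :
  ctmx (A *m B) = ctmx B *m ctmx A.
Proof. by rewrite /ctmx map_mxM trmx_mul. Qed.

Lemma ctmxD m n (A B : 'M[C]_(m, n)) : ctmx (A + B) = ctmx A + ctmx B.
Proof. by rewrite /ctmx map_mxD linearD. Qed.

Lemma ctmxN m n (A : 'M[C]_(m, n)) : ctmx (- A) = - ctmx A.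
Proof. by rewrite /ctmx map_mxN linearN. Qed.

Lemma ctmxB m n (A B : 'M[C]_(m, n)) : ctmx (A - B) = ctmx A - ctmx B.
Proof. by rewrite ctmxD ctmxN. Qed.

Lemma ctmxZ m n (a : C) (A : 'M[C]_(m, n)) : ctmx (a *: A) = conjc a *: ctmx A.
Proof. by apply/matrixP => i j; rewrite !mxE rmorphM. Qed.

Lemma ctmx0 m n : ctmx (0 : 'M[C]_(m, n)) = 0.
Proof. by apply/matrixP => i j; rewrite !mxE rmorph0. Qed.

Lemma ctmx_scalar n (a : C) : ctmx (a%:M : 'M[C]_n) = (conjc a)%:M.
Proof. by rewrite /ctmx map_scalar_mx tr_scalar_mx. Qed.

Lemma ctmx1 n : ctmx (1%:M : 'M[C]_n) = 1%:M.
Proof. by rewrite ctmx_scalar rmorph1. Qed.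

Lemma ctmx_sum m n I (r : seq I) (p : pred I) (A : I -> 'M[C]_(m, n)) :
  ctmx (\sum_(k <- r | p k) A k) = \sum_(k <- r | p k) ctmx (A k).
Proof.
by apply: (big_morph (@ctmx R m n)) => [X Y|]; rewrite ?ctmxD ?ctmx0.
Qed.

Lemma ctmx_inv n (A : 'M[C]_n) : ctmx (invmx A) = invmx (ctmx A).
Proof. by rewrite /ctmx map_invmx trmx_inv. Qed.

Lemma unitmx_ctmx n (A : 'M[C]_n) : (ctmx A \in unitmx) = (A \in unitmx).
Proof. by rewrite /ctmx unitmx_tr map_unitmx. Qed.

Lemma det_ctmx n (A : 'M[C]_n) : \det (ctmx A) = conjc (\det A).
Proof. by rewrite /ctmx det_tr det_map_mx. Qed.

Lemma mxtrace_ctmx n (A : 'M[C]_n) : \tr (ctmx A) = conjc (\tr A).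
Proof.
by rewrite /ctmx mxtrace_tr /mxtrace rmorph_sum; apply: eq_bigr => i _; rewrite mxE.
Qed.

Lemma Re_conjc (z : C) : complex.Re (conjc z) = complex.Re z. Proof. by case: z. Qed.

Lemma ReD (x y : C) : complex.Re (x + y) = complex.Re x + complex.Re y.
Proof. by case: x; case: y. Qed.

Lemma ReN (x : C) : complex.Re (- x) = - complex.Re x.
Proof. by case: x. Qed.

Lemma ReB (x y : C) : complex.Re (x - y) = complex.Re x - complex.Re y.
Proof. by rewrite ReD ReN. Qed.

Lemma Re_sum I (r : seq I) (p : pred I) (f : I -> C) :
  complex.Re (\sum_(k <- r | p k) f k) = \sum_(k <- r | p k) complex.Re (f k).
Proof. by apply: (big_morph (@complex.Re R)) => // x y; rewrite ReD. Qed.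

Lemma ReZ (a : R) (x : C) : complex.Re (a%:C * x) = a * complex.Re x.
Proof. by case: x => u v /=; rewrite mul0r subr0. Qed.

Lemma conj_mul (z : C) : z * conjc z = `|z| ^+ 2.
Proof. by rewrite normCK. Qed.

(** The real Frobenius inner product: complex matrices are treated as a real Euclidean space, which
    is the setting in which directions and gradients live. *)
Definition trip m n (A B : 'M[C]_(m, n)) : R := complex.Re (\tr (ctmx A *m B)).

Lemma tripC m n (A B : 'M[C]_(m, n)) : trip A B = trip B A.
Proof. by rewrite /trip -Re_conjc -mxtrace_ctmx ctmxM ctmxK. Qed.

Lemma tripDr m n (A B D : 'M[C]_(m, n)) : trip A (B + D) = trip A B + trip A D.
Proof. by rewrite /trip mulmxDr mxtraceD ReD. Qed.

Lemma tripNr m n (A B : 'M[C]_(m, n)) : trip A (- B) = - trip A B.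
Proof. by rewrite /trip mulmxN raddfN ReN. Qed.

Lemma tripZr m n (a : R) (A B : 'M[C]_(m, n)) : trip A (a%:C *: B) = a * trip A B.
Proof. by rewrite /trip -scalemxAr mxtraceZ ReZ. Qed.

Lemma tripDl m n (A B D : 'M[C]_(m, n)) : trip (A + B) D = trip A D + trip B D.
Proof. by rewrite tripC tripDr !(tripC D). Qed.

Lemma tripNl m n (A B : 'M[C]_(m, n)) : trip (- A) B = - trip A B.
Proof. by rewrite tripC tripNr tripC. Qed.

Lemma tripZl m n (a : R) (A B : 'M[C]_(m, n)) : trip (a%:C *: A) B = a * trip A B.
Proof. by rewrite tripC tripZr tripC. Qed.

Lemma mul_ctmx_tr m n (A : 'M[C]_(m, n)) :
  \tr (A *m ctmx A) = \sum_i \sum_j `|A i j| ^+ 2.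
Proof.
apply: eq_bigr => i _; rewrite mxE; apply: eq_bigr => j _.
by rewrite ctmxE conj_mul.
Qed.

Lemma tr_mul_ctmx_ge0 m n (A : 'M[C]_(m, n)) : 0 <= \tr (A *m ctmx A).
Proof.
by rewrite mul_ctmx_tr; apply: sumr_ge0 => i _; apply: sumr_ge0 => j _; rewrite exprn_ge0.
Qed.

Lemma Re_ge0 (z : C) : 0 <= z -> 0 <= complex.Re z.
Proof. by rewrite lecE => /andP[]. Qed.

Lemma ge0_ReK (z : C) : 0 <= z -> (complex.Re z)%:C = z.
Proof. by move=> /ger0_real /RRe_real. Qed.

Lemma tripxx m n (A : 'M[C]_(m, n)) : trip A A = complex.Re (\tr (A *m ctmx A)).
Proof. by rewrite /trip mxtrace_mulC. Qed.

Lemma trip_ge0 m n (A : 'M[C]_(m, n)) : 0 <= trip A A.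
Proof. by rewrite tripxx; apply/Re_ge0/tr_mul_ctmx_ge0. Qed.

Lemma trip_eq0 m n (A : 'M[C]_(m, n)) : trip A A = 0 -> A = 0.
Proof.
rewrite tripxx => trA0.
have : \tr (A *m ctmx A) = 0 by rewrite -[LHS]ge0_ReK ?tr_mul_ctmx_ge0 // trA0.
rewrite mul_ctmx_tr => /psumr_eq0P hA.
apply/matrixP => i j; rewrite mxE; apply/eqP; rewrite -normr_eq0 -sqrf_eq0; apply/eqP.
have /psumr_eq0P hi : \sum_j `|A i j| ^+ 2 = 0.
  by apply: hA => // k _; apply: sumr_ge0 => *; rewrite exprn_ge0.
by apply: hi => // *; rewrite exprn_ge0.
Qed.

End ConjugateTranspose.

(** * Positive definite matrices and the concavity of ln det *)

Section PositiveDefinite.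
Context {R : realType}.
Local Notation C := R[i].

Definition qform n (A : 'M[C]_n) (v : 'rV[C]_n) : C := (v *m A *m ctmx v) ord0 ord0.

(** In the order of [C], [0 <= z] also says that z is real. *)
Definition psdmx n (A : 'M[C]_n) := ctmx A = A /\ forall v, 0 <= qform A v.
Definition pdmx n (A : 'M[C]_n) := ctmx A = A /\ forall v, v != 0 -> 0 < qform A v.

Lemma qformD n (A B : 'M[C]_n) v : qform (A + B) v = qform A v + qform B v.
Proof. by rewrite /qform mulmxDr mulmxDl mxE. Qed.

Lemma qform_congr n p (A : 'M[C]_n) (B : 'M[C]_(p, n)) v :
  qform (B *m A *m ctmx B) v = qform A (v *m B).
Proof. by rewrite /qform ctmxM !mulmxA. Qed.

Lemma qform1 n (v : 'rV[C]_n) : qform 1%:M v = \sum_j `|v ord0 j| ^+ 2.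
Proof.
rewrite /qform mulmx1 mxE; apply: eq_bigr => j _; by rewrite ctmxE conj_mul.
Qed.

Lemma qform1_tr n (v : 'rV[C]_n) : qform 1%:M v = \tr (v *m ctmx v).
Proof. by rewrite qform1 mul_ctmx_tr big_ord1. Qed.

Lemma qform1_ge0 n (v : 'rV[C]_n) : 0 <= qform 1%:M v.
Proof. by rewrite qform1; apply: sumr_ge0 => j _; rewrite exprn_ge0. Qed.

Lemma qform1_eq0 n (v : 'rV[C]_n) : qform 1%:M v = 0 -> v = 0.
Proof.
rewrite qform1_tr => h; apply: trip_eq0.
by rewrite tripxx h.
Qed.

Lemma qform1_gt0 n (v : 'rV[C]_n) : v != 0 -> 0 < qform 1%:M v.
Proof.
move=> v0; rewrite lt_neqAle qform1_ge0 andbT eq_sym.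
by apply: contraNN v0 => /eqP /qform1_eq0 ->.
Qed.

Lemma psdmxD n (A B : 'M[C]_n) : psdmx A -> psdmx B -> psdmx (A + B).
Proof.
move=> [hA pA] [hB pB]; split=> [|v]; first by rewrite ctmxD hA hB.
by rewrite qformD addr_ge0.
Qed.

Lemma psdmx0 n : psdmx (0 : 'M[C]_n).
Proof. by split=> [|v]; rewrite ?ctmx0 // /qform mulmx0 mul0mx mxE. Qed.

Lemma psdmx_sum n I (r : seq I) (p : pred I) (A : I -> 'M[C]_n) :
  (forall k, psdmx (A k)) -> psdmx (\sum_(k <- r | p k) A k).
Proof. by move=> h; apply: big_ind => //; [exact: psdmx0|exact: psdmxD]. Qed.

Lemma psdmx_congr n p (A : 'M[C]_n) (B : 'M[C]_(p, n)) :
  psdmx A -> psdmx (B *m A *m ctmx B).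
Proof.
move=> [hA pA]; split=> [|v]; first by rewrite !ctmxM ctmxK hA mulmxA.
by rewrite qform_congr.
Qed.

Lemma pdmx1 n : pdmx (1%:M : 'M[C]_n).
Proof. by split=> [|v]; [rewrite ctmx1|exact: qform1_gt0]. Qed.

Lemma pdmx_psd n (A : 'M[C]_n) : pdmx A -> psdmx A.
Proof.
move=> [hA pA]; split=> // v; have [->|/pA/ltW//] := eqVneq v 0.
by rewrite /qform !mul0mx mxE.
Qed.

Lemma psdmx_gram n p (A : 'M[C]_(n, p)) : psdmx (A *m ctmx A).
Proof. by have := psdmx_congr A (pdmx_psd (pdmx1 p)); rewrite mulmx1. Qed.

Lemma pdmx_congr n (A : 'M[C]_n) (B : 'M[C]_n) : B \in unitmx ->
  pdmx A -> pdmx (B *m A *m ctmx B).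
Proof.
move=> uB pA; have [hA _] := pdmx_psd pA.
split=> [|v v0]; first by rewrite !ctmxM ctmxK hA mulmxA.
rewrite qform_congr; apply: pA.2; apply: contraNN v0 => /eqP h.
by rewrite -(mulmxK uB v) h mul0mx.
Qed.

Lemma pdmx_gram n (A : 'M[C]_n) : A \in unitmx -> pdmx (A *m ctmx A).
Proof. by move=> uA; have := pdmx_congr uA (pdmx1 n); rewrite mulmx1. Qed.

Lemma psdmxDpd n (A B : 'M[C]_n) : psdmx A -> pdmx B -> pdmx (A + B).
Proof.
move=> [hA pA] [hB pB]; split=> [|v v0]; first by rewrite ctmxD hA hB.
by rewrite qformD ltr_wpDl // pB.
Qed.

Lemma pdmx_scalar n (a : R) : 0 < a -> pdmx ((a%:C)%:M : 'M[C]_n).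
Proof.
move=> a0; split=> [|v v0]; first by rewrite ctmx_scalar conjc_real.
have := qform1_gt0 v0; rewrite /qform mulmx1 => h.
by rewrite mul_mx_scalar -scalemxAl mxE mulr_gt0 // ltcR.
Qed.

Lemma pdmx_unit n (A : 'M[C]_n) : pdmx A -> A \in unitmx.
Proof.
move=> [_ pA]; rewrite unitmxE unitfE; apply/negP => /det0P[v v0 vA].
by have := pA v v0; rewrite /qform vA mul0mx mxE ltxx.
Qed.

Lemma psdmx_diag_ge0 n (A : 'M[C]_n) i : psdmx A -> 0 <= A i i.
Proof.
move=> [_ /(_ (delta_mx ord0 i))]; rewrite /qform -rowE mxE (bigD1 i) //= big1 => [|j ji].
  by rewrite addr0 !mxE !eqxx conjc_nat mulr1.
by rewrite !mxE (negbTE ji) andbF conjc_nat mulr0.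
Qed.

Lemma psdmx_tr_ge0 n (A : 'M[C]_n) : psdmx A -> 0 <= \tr A.
Proof. by move=> pA; apply: sumr_ge0 => i _; exact: psdmx_diag_ge0. Qed.

(** Spectral theorem for Hermitian matrices. The diagonal matrix is congruent to [A], hence
    definite: its entries are nonnegative, and nonzero because its determinant is. *)
Lemma pdmx_diagonalize n (A : 'M[C]_n) : pdmx A ->
  exists (U : 'M[C]_n) (s : 'I_n -> R), [/\ U \in unitmx, invmx U = ctmx U,
    forall i, 0 < s i & A = ctmx U *m diag_mx (\row_i (s i)%:C) *m U].
Proof.
move=> pA; have [hA posA] := pA.
have hermA : A \is hermsymmx.
  by apply/is_hermitianmxP; rewrite expr0 scale1r -[LHS]hA /ctmx map_trmx.
set U := spectralmx A; have uU : U \in unitmx by exact: spectral_unit.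
have iU : invmx U = ctmx U.
  by rewrite invmx_unitary ?spectral_unitarymx// /ctmx map_trmx.
have eA : A = invmx U *m diag_mx (spectral_diag A) *m U.
  exact/orthomx_spectralP/hermitian_normalmx.
have pD : pdmx (diag_mx (spectral_diag A)).
  rewrite (_ : diag_mx _ = U *m A *m ctmx U); first exact: pdmx_congr.
  by rewrite {2}eA -iU !mulmxA mulmxV // mul1mx mulmxK.
have sp i : 0 < spectral_diag A ord0 i.
  have := (pdmx_unit pD); have := psdmx_diag_ge0 i (pdmx_psd pD).
  rewrite mxE eqxx mulr1n => h; rewrite unitmxE det_diag unitfE => /prodf_neq0/(_ i isT) h0.
  by rewrite lt_neqAle eq_sym h0.
exists U, (fun i => complex.Re (spectral_diag A ord0 i)); split; [exact: uU|exact: iU|move=> i|].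
  by have := sp i; rewrite ltcE => /andP[].
rewrite {1}eA iU; congr (_ *m diag_mx _ *m _).
by apply/rowP => i; rewrite mxE ge0_ReK // ltW.
Qed.

Lemma pdmx_factor n (A : 'M[C]_n) : pdmx A ->
  exists2 B : 'M[C]_n, B \in unitmx & A = B *m ctmx B.
Proof.
move=> /pdmx_diagonalize[U [s [uU iU s0 ->]]].
exists (ctmx U *m diag_mx (\row_i (Num.sqrt (s i))%:C)).
  rewrite unitmx_mul unitmx_ctmx uU unitmxE det_diag unitfE.
  apply/prodf_neq0 => i _; rewrite mxE -(rmorph0 (real_complex R)).
  by rewrite (inj_eq (@complexI _)) gt_eqF // sqrtr_gt0.
rewrite ctmxM ctmxK !mulmxA; congr (_ *m _); rewrite -mulmxA; congr (_ *m _).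
apply/matrixP => i j; rewrite mul_diag_mx !mxE.
have [->|ji] := eqVneq j i; last by rewrite !mulr0n rmorph0 mulr0.
by rewrite ?eqxx !mulr1n conjc_real -rmorphM /= -expr2 sqr_sqrtr // ltW.
Qed.

Lemma det_gram n (B : 'M[C]_n) : \det (B *m ctmx B) = `|\det B| ^+ 2.
Proof. by rewrite det_mulmx det_ctmx conj_mul. Qed.

Lemma pdmx_det_gt0 n (A : 'M[C]_n) : pdmx A -> 0 < \det A.
Proof.
move=> /pdmx_factor[B uB ->]; rewrite det_gram exprn_gt0 // normr_gt0 -unitfE.
by rewrite -unitmxE.
Qed.

Lemma pdmx_Re_det_gt0 n (A : 'M[C]_n) : pdmx A -> 0 < complex.Re (\det A).
Proof. by move=> /pdmx_det_gt0; rewrite ltcE => /andP[]. Qed.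

Lemma ln_le_subr1 (x : R) : 0 < x -> ln x <= x - 1.
Proof.
move=> x0; have := @le_ln1Dx R (x - 1); rewrite [1 + _]addrC subrK; apply.
by move: x0; lra.
Qed.

Lemma ln_prod n (s : 'I_n -> R) : (forall i, 0 < s i) ->
  ln (\prod_i s i) = \sum_i ln (s i).
Proof.
move=> s0; suff : 0 < \prod_i s i /\ ln (\prod_i s i) = \sum_i ln (s i) by case.
elim/big_rec2: _ => [|i x y _ [y0 yx]]; first by rewrite ln1.
by split; [rewrite mulr_gt0|rewrite lnM ?posrE // yx].
Qed.

(** The tangent of ln det at the identity, obtained by summing ln s <= s - 1 over the
    eigenvalues. *)
Lemma ln_det_le_tr n (A : 'M[C]_n) : pdmx A ->
  ln (complex.Re (\det A)) <= complex.Re (\tr A) - n%:R.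
Proof.
move=> /pdmx_diagonalize[U [s [uU iU s0 ->]]].
rewrite -mulmxA [X in X - _]/= mxtrace_mulC -mulmxA -iU mulmxV // mulmx1.
rewrite mulmxA !det_mulmx mulrAC -det_mulmx mulVmx // det1 mul1r det_diag mxtrace_diag.
under eq_bigr do rewrite mxE; under [in X in _ <= X]eq_bigr do rewrite mxE.
rewrite -rmorph_prod -rmorph_sum /= ln_prod //.
rewrite -[n%:R](_ : \sum_(i < n) 1 = _); last by rewrite sumr_const card_ord.
by rewrite -sumrB; apply: ler_sum => i _; exact: ln_le_subr1.
Qed.

Lemma pdmx_inv n (A : 'M[C]_n) : pdmx A -> pdmx (invmx A).
Proof.
move=> pA; have uA := pdmx_unit pA; have [hA _] := pA.
have := pdmx_congr (A := A) (B := invmx A); rewrite unitmx_inv => /(_ uA pA).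
by rewrite ctmx_inv hA mulVmx // mul1mx.
Qed.

Lemma tr_inv_psd_ge0 n (A D : 'M[C]_n) : pdmx A -> psdmx D ->
  0 <= complex.Re (\tr (invmx A *m D)).
Proof.
move=> /pdmx_inv/pdmx_factor[B _ ->] pD; rewrite -mulmxA mxtrace_mulC.
apply/Re_ge0/psdmx_tr_ge0; have := psdmx_congr (ctmx B) pD; by rewrite ctmxK.
Qed.

(* Concavity of ln det at X0, followed by Loewner monotonicity of the linear term. *)
Lemma ln_det_tangent n (X X0 E : 'M[C]_n) : pdmx X -> pdmx X0 -> psdmx (E - X) ->
  ln (complex.Re (\det X)) <=
  ln (complex.Re (\det X0)) + complex.Re (\tr (invmx X0 *m (E - X0))).
Proof.
move=> pX pX0 pE; have uX0 := pdmx_unit pX0.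
(* Whitening: with X0^-1 = B B^H, the matrix B^H X B has determinant det X / det X0 and trace
   tr(X0^-1 X), so the tangent at the identity transports to X0. *)
have [B uB eB] := pdmx_factor (pdmx_inv pX0).
have pY : pdmx (ctmx B *m X *m ctmx (ctmx B)).
  by apply: pdmx_congr => //; rewrite unitmx_ctmx.
have := ln_det_le_tr pY; rewrite ctmxK mxtrace_mulC mulmxA -eB.
have -> : \det (ctmx B *m X *m B) = \det (invmx X0) * \det X.
  by rewrite eB !det_mulmx; ring.
have dX0 := pdmx_det_gt0 pX0; have dX := pdmx_det_gt0 pX.
have rX0 := pdmx_Re_det_gt0 pX0; have rX := pdmx_Re_det_gt0 pX.
rewrite det_inv -[\det X0]ge0_ReK; last exact: ltW.
rewrite -[\det X]ge0_ReK; last exact: ltW.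
rewrite -fmorphV -rmorphM /= lnM ?posrE ?invr_gt0 // lnV ?posrE // => h.
have := tr_inv_psd_ge0 pX0 pE.
have trB (Y Z : 'M[C]_n) : complex.Re (\tr (Y - Z)) = complex.Re (\tr Y) - complex.Re (\tr Z).
  by rewrite raddfB ReB.
rewrite !mulmxBr !trB mulVmx // mxtrace1 -(rmorph_nat (real_complex R)) /=.
by move: h; lra.
Qed.
End PositiveDefinite.

(** * Linear estimation *)

(* Matrix identities: expand into monomials, abstract each monomial, compare entrywise. *)
Ltac mx_expand := rewrite ?(ctmxD, ctmxN, ctmxM, ctmxK, ctmx1, ctmxZ, mulmxDl, mulmxDr, mulmxN,
  mulNmx, mul1mx, mulmx1, mul_mx_scalar, mul_scalar_mx, scalerDr, scalerN, mulmxA).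
Ltac mx_entrywise :=
  repeat match goal with |- context [@mulmx ?R ?m ?n ?p ?A ?B] =>
    let x := fresh in set x := (@mulmx R m n p A B); clearbody x end;
  apply/matrixP => ? ?; rewrite !mxE; ring.

Section Estimation.
Context {R : realType}.
Local Notation C := R[i].

Lemma row_cauchy_schwarz n (u v : 'rV[C]_n) :
  `|(u *m ctmx v) ord0 ord0| ^+ 2 <= qform 1%:M u * qform 1%:M v.
Proof.
have := (CauchySchwarz (@dotmx C n) u v).1.
have dotE (x y : 'rV[C]_n) : dotmx x y = (x *m ctmx y) ord0 ord0.
  by rewrite dotmxE /ctmx map_trmx.
by rewrite /= !dotE /qform !mulmx1.
Qed.

(** Cauchy-Schwarz for each column of [M]; the Frobenius norm stands in for the operator norm. *)
Lemma qform1_mul_le m n (x : 'rV[C]_m) (M : 'M[C]_(m, n)) :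
  qform 1%:M (x *m M) <= qform 1%:M x * \tr (M *m ctmx M).
Proof.
rewrite qform1 mul_ctmx_tr exchange_big /= mulr_sumr; apply: ler_sum => j _.
have := row_cauchy_schwarz x (\row_i conjc (M i j)).
rewrite [X in _ * X]qform1.
under [X in _ * X]eq_bigr do rewrite mxE norm_conjC.
suff -> : x *m ctmx (\row_i conjc (M i j)) = col j (x *m M) by rewrite mxE.
by rewrite colE -mulmxA -colE; congr (_ *m _); apply/matrixP => i k; rewrite !mxE conjcK.
Qed.

(** The hypothesis is the diagonal part of M M^H <= c M. It first gives |M_ii|^2 <= c |M_ii|, hence
    |M_ii| <= c, and then |M_ij|^2 <= c |M_ii| <= c^2. *)
Lemma entry_le_of_row_sqnorm_le n (M : 'M[C]_n) (c : C) : 0 <= c ->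
  (forall i, \sum_j `|M i j| ^+ 2 <= c * M i i) -> forall i j, `|M i j| <= c.
Proof.
move=> c0 hM.
have sq i j : `|M i j| ^+ 2 <= c * `|M i i|.
  have h : `|M i j| ^+ 2 <= c * M i i.
    apply: le_trans (hM i); rewrite (bigD1 j) //= lerDl.
    by apply: sumr_ge0 => k _; rewrite exprn_ge0.
  by apply: (le_trans h); rewrite -[X in X <= _]ger0_norm ?normrM ?(ger0_norm c0) // (le_trans _ h) // exprn_ge0.
have diag i : `|M i i| <= c.
  have := sq i i; rewrite expr2; have [->//|m0] := eqVneq (`|M i i|) 0.
  by rewrite ler_pM2r // lt_neqAle eq_sym m0 normr_ge0.
move=> i j; rewrite -(ler_pXn2r (n := 2)) ?nnegrE // expr2 [c ^+ 2]expr2.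
by rewrite -expr2; apply: le_trans (sq i j) _; rewrite ler_wpM2l.
Qed.

Lemma qform1_le_gram n (P Pi : 'M[C]_n) v : P *m Pi = 1%:M ->
  qform 1%:M v <= \tr (Pi *m ctmx Pi) * qform (P *m ctmx P) v.
Proof.
move=> PPi; have := qform1_mul_le (v *m P) Pi; rewrite -mulmxA PPi mulmx1 mulrC.
by rewrite -[P in _ <= _ * qform (P *m _) _]mulmx1 qform_congr.
Qed.

Variables (n r : nat) (N0 : R) (F S X I P : 'M[C]_n) (H : 'M[C]_(r, n)).
Hypotheses (N0_gt0 : 0 < N0) (S_psd : psdmx S) (I_psd : psdmx I).
Hypotheses (P_unit : P \in unitmx) (XE : X = P *m ctmx P).

(** Model of one receiver: u = F s + x is estimated from y = H (s + x + i) + z, with uncorrelated s,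
    x, i, z of covariances S, X, I and N0 times the identity. [outcov] is the covariance of y, and
    [crosscov] is that of u with s + x. *)
Definition outcov : 'M[C]_r := H *m (S + X) *m ctmx H + (H *m I *m ctmx H + (N0%:C)%:M).
Definition crosscov : 'M[C]_n := F *m S + X.
Definition lmmse : 'M[C]_(n, r) := crosscov *m ctmx H *m invmx outcov.
Definition condcov : 'M[C]_n := F *m S *m ctmx F + X - lmmse *m H *m ctmx crosscov.

(* Error covariance of the linear estimate W y of u. *)
Definition errcov (W : 'M[C]_(n, r)) : 'M[C]_n :=
  (F - W *m H) *m S *m ctmx (F - W *m H) + (1%:M - W *m H) *m X *m ctmx (1%:M - W *m H)
  + (W *m H) *m I *m ctmx (W *m H) + N0%:C *: (W *m ctmx W).

Let X_pd : pdmx X. Proof. by rewrite XE; exact: pdmx_gram. Qed.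
Let hS : ctmx S = S. Proof. exact: S_psd.1. Qed.
Let hI : ctmx I = I. Proof. exact: I_psd.1. Qed.
Let hX : ctmx X = X. Proof. exact: X_pd.1. Qed.

Lemma outcov_pd : pdmx outcov.
Proof.
rewrite /outcov; apply: psdmxDpd; first exact/psdmx_congr/psdmxD/pdmx_psd.
by apply: psdmxDpd; [exact: psdmx_congr|exact: pdmx_scalar].
Qed.

(** Completion of the square around [lmmse], which solves the normal equation
    [lmmse *m outcov = crosscov *m ctmx H]. *)
Lemma errcovE W : errcov W = condcov + (W - lmmse) *m outcov *m ctmx (W - lmmse).
Proof.
have uK := pdmx_unit outcov_pd; have hK := outcov_pd.1.
have WK : lmmse *m outcov = crosscov *m ctmx H by rewrite /lmmse mulmxKV.
have KW : outcov *m ctmx lmmse = H *m ctmx crosscov.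
  by rewrite -[outcov]hK -ctmxM WK ctmxM ctmxK.
have -> : (W - lmmse) *m outcov *m ctmx (W - lmmse) =
  W *m outcov *m ctmx W - W *m H *m ctmx crosscov - crosscov *m ctmx H *m ctmx W
  + lmmse *m H *m ctmx crosscov.
  rewrite ctmxB mulmxBr !mulmxBl WK -(mulmxA W outcov (ctmx lmmse)) KW !mulmxA.
  have -> : crosscov *m ctmx H *m ctmx lmmse = lmmse *m H *m ctmx crosscov.
    by rewrite -WK -mulmxA KW mulmxA.
  mx_entrywise.
rewrite /errcov /condcov; set Z := lmmse *m H *m ctmx crosscov.
rewrite /outcov /crosscov; mx_expand; rewrite ?hS ?hX ?hI -?scalemxAl; mx_entrywise.
Qed.

Lemma errcov_lmmse : errcov lmmse = condcov.
Proof. by rewrite errcovE subrr mul0mx mul0mx addr0. Qed.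

Lemma errcov_ge W : psdmx (errcov W - condcov).
Proof. by rewrite errcovE addrC addKr; exact/psdmx_congr/pdmx_psd/outcov_pd. Qed.

(** The squared Frobenius norm of P^-1 stacked on H / sqrt N0, which is the matrix [M] of the next
    proof. *)
Definition condcov_bound : C :=
  \tr (invmx P *m ctmx (invmx P)) + (N0^-1)%:C * \tr (H *m ctmx H).

Lemma condcov_bound_ge0 : 0 <= condcov_bound.
Proof.
by rewrite addr_ge0 ?mulr_ge0 ?tr_mul_ctmx_ge0 // lecR invr_ge0 ltW.
Qed.

(* Write v = v (1 - W H) + (v W) H and apply Cauchy-Schwarz to the two blocks. *)
Lemma qform1_le_condcov v : qform 1%:M v <= condcov_bound * qform condcov v.
Proof.
rewrite -errcov_lmmse; set W := lmmse; set s := Num.sqrt N0.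
have s2 : s * s = N0 by rewrite -expr2 sqr_sqrtr // ltW.
have s0 : s != 0 by rewrite gt_eqF // sqrtr_gt0.
(* The factor sqrt N0 is placed so that |x|^2 is exactly the X term plus the noise term of
   [errcov W] at v; the S and I terms are nonnegative and are dropped at the end. *)
pose x := row_mx (v *m (1%:M - W *m H) *m P) (s%:C *: (v *m W)).
pose M := col_mx (invmx P) ((s^-1)%:C *: H).
have vE : v = x *m M.
  rewrite mul_row_col mulmxK // -scalemxAl -scalemxAr scalerA -rmorphM /= divff // scale1r.
  by rewrite mulmxBr mulmx1 mulmxA subrK.
have trM : \tr (M *m ctmx M) = condcov_bound.
  have -> : ctmx M = row_mx (ctmx (invmx P)) ((s^-1)%:C *: ctmx H).
    by rewrite /M /ctmx map_col_mx tr_col_mx map_mxZ linearZ /= oppr0.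
  rewrite mul_col_row mxtrace_block -scalemxAl -scalemxAr scalerA -rmorphM -invfM s2.
  by rewrite mxtraceZ.
have xE : qform 1%:M x = qform X (v *m (1%:M - W *m H)) + N0%:C * qform 1%:M (v *m W).
  rewrite XE -[P in P *m _]mulmx1 qform_congr !qform1_tr.
  have -> : ctmx x = col_mx (ctmx (v *m (1%:M - W *m H) *m P)) (s%:C *: ctmx (v *m W)).
    by rewrite /x /ctmx map_row_mx tr_row_mx map_mxZ linearZ /= oppr0.
  by rewrite mul_row_col mxtraceD -scalemxAl -scalemxAr scalerA -rmorphM s2 mxtraceZ.
rewrite {1}vE; apply: le_trans (qform1_mul_le x M) _; rewrite trM mulrC.
apply: ler_wpM2l; first exact: condcov_bound_ge0.
rewrite xE /errcov !qformD !qform_congr.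
rewrite [qform (_ *: _) _](_ : _ = N0%:C * qform 1%:M (v *m W)); last first.
  rewrite /qform mulmx1 -scalemxAr -scalemxAl mxE ctmxM !mulmxA //.
rewrite lerD2r -addrA addrCA lerDl addr_ge0 //; [exact: S_psd.2|exact: I_psd.2].
Qed.

(** Hermitian symmetry comes from the form of [errcov] as a sum of congruences; strict positivity
    comes from the coercivity bound just shown. *)
Lemma condcov_pd : pdmx condcov.
Proof.
split=> [|v v0].
  suff [] : psdmx (errcov lmmse) by rewrite errcov_lmmse.
  have -> : errcov lmmse = errcov lmmse - N0%:C *: (lmmse *m ctmx lmmse)
      + lmmse *m (N0%:C)%:M *m ctmx lmmse.
    by rewrite mul_mx_scalar -scalemxAl subrK.
  rewrite /errcov addrK; have N0I : psdmx ((N0%:C)%:M : 'M[C]_r) by exact/pdmx_psd/pdmx_scalar.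
  have Xp := pdmx_psd X_pd.
  by do 3![apply: psdmxD; last exact: psdmx_congr]; exact: psdmx_congr.
have := qform1_le_condcov v; have := qform1_gt0 v0 => /lt_le_trans/[apply].
have [->|b0] := eqVneq condcov_bound 0; first by rewrite mul0r ltxx.
by rewrite pmulr_rgt0 // lt_neqAle eq_sym b0 condcov_bound_ge0.
Qed.

(** The test vector is row i of the inverse [Si]: there the form of [condcov] equals [Si i i], which
    is the hypothesis of the entrywise bound. *)
Lemma inv_condcov_entry_le i j : `|invmx condcov i j| <= condcov_bound.
Proof.
apply: entry_le_of_row_sqnorm_le condcov_bound_ge0 _ i j => i.
set Si := invmx condcov; have uC := pdmx_unit condcov_pd.
have hSi : ctmx Si = Si by case: (pdmx_inv condcov_pd).
have := qform1_le_condcov (row i Si); rewrite qform1.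
under eq_bigr do rewrite mxE.
suff -> : qform condcov (row i Si) = Si i i by [].
rewrite /qform -row_mul mulVmx // rowE mulmx1 -rowE -[in RHS]hSi.
by rewrite ctmxE !mxE.
Qed.

(** [crosscov] times this matrix is the filter seen from the channel input, that is [Tmx]. *)
Definition gainmx : 'M[C]_n := ctmx H *m invmx outcov *m H.

(** The bound does not depend on H. Since H Q H^H = [outcov] - N0 I, the gain M satisfies M Q M <=
    M, and Q >= X = P P^H turns this into a bound of the squared row norm by M_ii. *)
Lemma gainmx_entry_le i j : `|gainmx i j| <= \tr (invmx P *m ctmx (invmx P)).
Proof.
apply: entry_le_of_row_sqnorm_le (tr_mul_ctmx_ge0 _) _ i j => i; set M := gainmx.
have uK := pdmx_unit outcov_pd; have [hKi _] := pdmx_inv outcov_pd.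
have hM : ctmx M = M by rewrite /M /gainmx !ctmxM ctmxK hKi mulmxA.
have := qform1_le_gram (row i M) (mulmxV P_unit); rewrite -XE qform1.
under eq_bigr do rewrite mxE.
move=> /le_trans; apply; apply: ler_wpM2l; first exact: tr_mul_ctmx_ge0.
set Q := S + X + I.
have MQ : M - M *m Q *m ctmx M = N0%:C *: ((ctmx H *m invmx outcov) *m ctmx (ctmx H *m invmx outcov)).
  rewrite hM [ctmx (_ *m _)]ctmxM ctmxK hKi.
  have -> : M *m Q *m M = ctmx H *m invmx outcov *m (outcov - (N0%:C)%:M) *m (invmx outcov *m H).
    have -> : outcov - (N0%:C)%:M = H *m Q *m ctmx H.
      by rewrite /outcov addrA addrK -mulmxDl -mulmxDr.
    by rewrite /M /gainmx !mulmxA.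
  rewrite mulmxBr mulmxBl mulmxKV // !mulmxA -/M opprB addrC subrK.
  by rewrite mul_mx_scalar -!scalemxAl.
have le_MQ : (M *m Q *m ctmx M) i i <= M i i.
  rewrite -subr_ge0; have := psdmx_diag_ge0 i (psdmx_gram (ctmx H *m invmx outcov)).
  have subE (Y Z : 'M[C]_n) : Y i i - Z i i = (Y - Z) i i by rewrite !mxE.
  by move=> h; rewrite subE MQ mxE mulr_ge0 // lecR ltW.
apply: le_trans le_MQ.
have -> : (M *m Q *m ctmx M) i i = qform Q (row i M).
  rewrite /qform -row_mul mxE [RHS]mxE; apply: eq_bigr => k _; by rewrite !mxE.
rewrite /Q !qformD addrAC lerDr addr_ge0 //; [exact: S_psd.2|exact: I_psd.2].
Qed.

End Estimation.

(** * Measurability and integrability of random matrices *)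

Section Measurability.
Context {R : realType} {d : measure_display} {T : measurableType d}.
Local Notation C := R[i].
Implicit Types f g : T -> C.

Definition cmeasurable f :=
  measurable_fun setT (fun w => complex.Re (f w)) /\
  measurable_fun setT (fun w => complex.Im (f w)).

Lemma cmeasurable_cst (c : C) : cmeasurable (fun=> c).
Proof. by split; exact: measurable_cst. Qed.

Lemma cmeasurableD f g : cmeasurable f -> cmeasurable g ->
  cmeasurable (fun w => f w + g w).
Proof.
move=> [fr fi] [gr gi]; split.
- rewrite [X in measurable_fun _ X](_ : _ = (fun w => complex.Re (f w)) \+ (fun w => complex.Re (g w))).
    exact: measurable_funD.
  by apply/funext => w /=; case: (f w); case: (g w).
- rewrite [X in measurable_fun _ X](_ : _ = (fun w => complex.Im (f w)) \+ (fun w => complex.Im (g w))).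
    exact: measurable_funD.
  by apply/funext => w /=; case: (f w); case: (g w).
Qed.

Lemma cmeasurableM f g : cmeasurable f -> cmeasurable g ->
  cmeasurable (fun w => f w * g w).
Proof.
move=> [fr fi] [gr gi]; split.
- rewrite [X in measurable_fun _ X](_ : _ =
    ((fun w => complex.Re (f w)) \* (fun w => complex.Re (g w))) \-
    ((fun w => complex.Im (f w)) \* (fun w => complex.Im (g w)))).
    by apply: measurable_funB; exact: measurable_funM.
  by apply/funext => w /=; case: (f w); case: (g w).
- rewrite [X in measurable_fun _ X](_ : _ =
    ((fun w => complex.Re (f w)) \* (fun w => complex.Im (g w))) \+
    ((fun w => complex.Im (f w)) \* (fun w => complex.Re (g w)))).
    by apply: measurable_funD; exact: measurable_funM.
  by apply/funext => w /=; case: (f w); case: (g w).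
Qed.

Lemma cmeasurable_conj f : cmeasurable f -> cmeasurable (fun w => conjc (f w)).
Proof.
move=> [fr fi]; split.
- by rewrite [X in measurable_fun _ X](_ : _ = fun w => complex.Re (f w)) //; apply/funext => w; case: (f w).
- rewrite [X in measurable_fun _ X](_ : _ = \- (fun w => complex.Im (f w))).
    exact: measurable_funN.
  by apply/funext => w /=; case: (f w).
Qed.

Lemma cmeasurableV f : cmeasurable f -> cmeasurable (fun w => (f w)^-1).
Proof.
move=> [fr fi].
pose q w : R := complex.Re (f w) ^+ 2 + complex.Im (f w) ^+ 2.
have mq : measurable_fun setT (fun w => (q w)^-1).
  (* At [q w = 0] both sides are 0, so zeros of [f] need no separate treatment. *)
  have -> : (fun w => (q w)^-1) = (@powR R ^~ (-1)) \o q.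
    by apply/funext => w /=; rewrite powR_inv1 // addr_ge0 // sqr_ge0.
  apply: measurableT_comp; first exact: measurable_powR.
  by apply: measurable_funD; exact: measurable_funX.
split.
- rewrite [X in measurable_fun _ X](_ : _ = (fun w => complex.Re (f w)) \* (fun w => (q w)^-1)).
    exact: measurable_funM.
  by apply/funext => w /=; rewrite /q; case: (f w).
- rewrite [X in measurable_fun _ X](_ : _ = (\- (fun w => complex.Im (f w))) \* (fun w => (q w)^-1)).
    by apply: measurable_funM => //; exact: measurable_funN.
  by apply/funext => w /=; rewrite /q mulNr; case: (f w).
Qed.

Lemma cmeasurable_sum I (r : seq I) (F : I -> T -> C) :
  (forall k, cmeasurable (F k)) -> cmeasurable (fun w => \sum_(k <- r) F k w).
Proof.
move=> mF; elim: r => [|k r IH].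
  by under eq_fun do rewrite big_nil; exact: cmeasurable_cst.
by under eq_fun do rewrite big_cons; exact: cmeasurableD.
Qed.

Lemma cmeasurable_prod I (r : seq I) (F : I -> T -> C) :
  (forall k, cmeasurable (F k)) -> cmeasurable (fun w => \prod_(k <- r) F k w).
Proof.
move=> mF; elim: r => [|k r IH].
  by under eq_fun do rewrite big_nil; exact: cmeasurable_cst.
by under eq_fun do rewrite big_cons; exact: cmeasurableM.
Qed.

Lemma random_matrixP m n (X : T -> 'M[C]_(m, n)) :
  random_matrix X <-> forall i j, cmeasurable (fun w => X w i j).
Proof. by []. Qed.

Lemma random_matrix_cst m n (A : 'M[C]_(m, n)) : random_matrix (fun _ : T => A).
Proof. by apply/random_matrixP => i j; exact: cmeasurable_cst. Qed.

Lemma random_matrixD m n (X Y : T -> 'M[C]_(m, n)) :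
  random_matrix X -> random_matrix Y -> random_matrix (fun w => X w + Y w).
Proof.
move=> mX mY; apply/random_matrixP => i j; under eq_fun do rewrite mxE.
by apply: cmeasurableD; [exact: mX|exact: mY].
Qed.

Lemma random_matrixM m n p (X : T -> 'M[C]_(m, n)) (Y : T -> 'M[C]_(n, p)) :
  random_matrix X -> random_matrix Y -> random_matrix (fun w => X w *m Y w).
Proof.
move=> mX mY; apply/random_matrixP => i j; under eq_fun do rewrite mxE.
by apply: cmeasurable_sum => k; apply: cmeasurableM; [exact: mX|exact: mY].
Qed.

Lemma random_matrixN m n (X : T -> 'M[C]_(m, n)) :
  random_matrix X -> random_matrix (fun w => - X w).
Proof.
move=> mX; apply/random_matrixP => i j; under eq_fun do rewrite mxE -mulN1r.
by apply: cmeasurableM; [exact: cmeasurable_cst|exact: mX].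
Qed.

Lemma random_matrix_ct m n (X : T -> 'M[C]_(m, n)) :
  random_matrix X -> random_matrix (fun w => ctmx (X w)).
Proof.
move=> mX; apply/random_matrixP => i j; under eq_fun do rewrite ctmxE.
by apply: cmeasurable_conj; exact: mX.
Qed.

Lemma cmeasurable_det n (X : T -> 'M[C]_n) :
  random_matrix X -> cmeasurable (fun w => \det (X w)).
Proof.
move=> mX; apply: cmeasurable_sum => s; apply: cmeasurableM; first exact: cmeasurable_cst.
by apply: cmeasurable_prod => i; exact: mX.
Qed.

(** By the adjugate formula, the entries are cofactors divided by the determinant. *)
Lemma random_matrix_inv n (X : T -> 'M[C]_n) : (forall w, X w \in unitmx) ->
  random_matrix X -> random_matrix (fun w => invmx (X w)).
Proof.
move=> uX mX; apply/random_matrixP => i j.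
under eq_fun do rewrite /invmx uX !mxE.
apply: cmeasurableM; first exact/cmeasurableV/cmeasurable_det.
apply: cmeasurableM; first exact: cmeasurable_cst.
apply: cmeasurable_det; apply/random_matrixP => k l.
by under eq_fun do rewrite !mxE; exact: mX.
Qed.

End Measurability.

(** * Envelopes for random matrices *)

Section Domination.
Context {R : realType} {d : measure_display} {T : measurableType d}.
Local Notation C := R[i].

(** The envelope [g] records the growth in [w]; the constant [k] absorbs dimensions and fixed
    matrices. *)
Definition dominated (g : T -> R) m n (X : T -> 'M[C]_(m, n)) :=
  random_matrix X /\ exists k : R, forall w i j, `|X w i j| <= (k * g w)%:C.

Lemma dominated_cst m n (A : 'M[C]_(m, n)) : dominated (fun=> 1) (fun=> A).
Proof.
split; first exact: random_matrix_cst.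
exists (complex.Re (\sum_i \sum_j `|A i j|)) => _ i j; rewrite mulr1 ge0_ReK; last first.
  by apply: sumr_ge0 => k _; apply: sumr_ge0.
rewrite (bigD1 i) //= (bigD1 j) //= -addrA lerDl addr_ge0 ?sumr_ge0 //.
by move=> k _; apply: sumr_ge0.
Qed.

Lemma dominatedD g m n (X Y : T -> 'M[C]_(m, n)) :
  dominated g X -> dominated g Y -> dominated g (fun w => X w + Y w).
Proof.
move=> [mX [k hX]] [mY [l hY]]; split; first exact: random_matrixD.
exists (k + l) => w i j; rewrite mxE mulrDl rmorphD /=.
by apply: le_trans (ler_normD _ _) _; rewrite lerD.
Qed.

Lemma dominatedN g m n (X : T -> 'M[C]_(m, n)) :
  dominated g X -> dominated g (fun w => - X w).
Proof.
move=> [mX [k hX]]; split; first exact: random_matrixN.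
by exists k => w i j; rewrite mxE normrN.
Qed.

Lemma dominatedB g m n (X Y : T -> 'M[C]_(m, n)) :
  dominated g X -> dominated g Y -> dominated g (fun w => X w - Y w).
Proof. by move=> hX hY; apply: dominatedD => //; exact: dominatedN. Qed.

Lemma dominated_ct g m n (X : T -> 'M[C]_(m, n)) :
  dominated g X -> dominated g (fun w => ctmx (X w)).
Proof.
move=> [mX [k hX]]; split; first exact: random_matrix_ct.
by exists k => w i j; rewrite ctmxE norm_conjC.
Qed.

Lemma dominated_mul g h m n p (X : T -> 'M[C]_(m, n)) (Y : T -> 'M[C]_(n, p)) :
  dominated g X -> dominated h Y -> dominated (fun w => g w * h w) (fun w => X w *m Y w).
Proof.
move=> [mX [k hX]] [mY [l hY]]; split; first exact: random_matrixM.
exists (k * l * n%:R) => w i j; rewrite mxE.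
apply: le_trans (ler_norm_sum _ _ _) _.
have -> : k * l * n%:R * (g w * h w) = \sum_(a < n) (k * g w) * (l * h w).
  by rewrite sumr_const card_ord -mulr_natr; ring.
by rewrite rmorph_sum; apply: ler_sum => a _; rewrite normrM rmorphM ler_pM.
Qed.

(** A bounded factor preserves the envelope, so T^H S T, whose only unbounded factor is S, keeps the
    envelope of S. *)
Lemma dominated_mulr g m n p (X : T -> 'M[C]_(m, n)) (Y : T -> 'M[C]_(n, p)) :
  dominated g X -> dominated (fun=> 1) Y -> dominated g (fun w => X w *m Y w).
Proof. by move=> hX hY; have := dominated_mul hX hY; under eq_fun do rewrite mulr1. Qed.

Lemma dominated_mull g m n p (X : T -> 'M[C]_(m, n)) (Y : T -> 'M[C]_(n, p)) :
  dominated (fun=> 1) X -> dominated g Y -> dominated g (fun w => X w *m Y w).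
Proof. by move=> hX hY; have := dominated_mul hX hY; under eq_fun do rewrite mul1r. Qed.

Lemma dominated_le g h m n (X : T -> 'M[C]_(m, n)) :
  (forall w, 0 <= g w <= h w) -> dominated g X -> dominated h X.
Proof.
move=> gh [mX [k hX]]; split => //; exists `|k| => w i j; have /andP[g0 gw] := gh w.
apply: le_trans (hX w i j) _; rewrite lecR.
by apply: le_trans (ler_wpM2r g0 (ler_norm k)) _; rewrite ler_wpM2l.
Qed.

End Domination.

(** * Expectations of real and matrix-valued variables *)

Section Expectation.
Context {R : realType} {d : measure_display} {T : measurableType d} (Pr : probability T R).
Local Notation C := R[i].
Implicit Types f g : T -> R.

Definition rintegrable f := Pr.-integrable setT (EFin \o f).

Lemma rintegrable_dom f g : measurable_fun setT f -> (forall w, `|f w| <= g w) ->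
  rintegrable g -> rintegrable f.
Proof.
move=> mf fg ig; apply: (le_integrable measurableT _ _ ig); first exact/measurable_EFinP.
by move=> w _ /=; rewrite lee_fin (le_trans (fg w)) // ler_norm.
Qed.

Lemma rintegrable_cst (k : R) : rintegrable (fun=> k).
Proof. exact: (finite_measure_integrable_cst Pr k measurableT). Qed.

Lemma rintegrableD f g : rintegrable f -> rintegrable g -> rintegrable (fun w => f w + g w).
Proof. by move=> hf hg; exact: (integrableD measurableT hf hg). Qed.

Lemma rintegrableZ (k : R) f : rintegrable f -> rintegrable (fun w => k * f w).
Proof. by move=> hf; exact: (integrableZl measurableT k hf). Qed.

Lemma rintegrable_sum I (r : seq I) (p : pred I) (f : I -> T -> R) :
  (forall k, rintegrable (f k)) -> rintegrable (fun w => \sum_(k <- r | p k) f k w).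
Proof.
move=> hf; elim: r => [|k r IH].
  by under eq_fun do rewrite big_nil; exact: rintegrable_cst.
by under eq_fun do rewrite big_cons; case: (p k) => //; exact: rintegrableD.
Qed.

Lemma ErealD f g : rintegrable f -> rintegrable g ->
  Ereal Pr (fun w => f w + g w) = Ereal Pr f + Ereal Pr g.
Proof. by move=> hf hg; rewrite /Ereal RintegralD. Qed.

Lemma ErealZ (k : R) f : rintegrable f -> Ereal Pr (fun w => k * f w) = k * Ereal Pr f.
Proof. by move=> hf; rewrite /Ereal RintegralZl. Qed.

Lemma Ereal_sum I (r : seq I) (p : pred I) (f : I -> T -> R) :
  (forall k, rintegrable (f k)) ->
  Ereal Pr (fun w => \sum_(k <- r | p k) f k w) = \sum_(k <- r | p k) Ereal Pr (f k).
Proof.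
move=> hf; elim: r => [|k r IH].
  under eq_fun do rewrite big_nil; rewrite big_nil.
  by rewrite /Ereal Rintegral_cst // mul0r.
under eq_fun do rewrite big_cons; rewrite big_cons; case: (p k) => //.
by rewrite ErealD // ?IH //; exact: rintegrable_sum.
Qed.

Lemma le_Ereal f g : rintegrable f -> rintegrable g -> (forall w, f w <= g w) ->
  Ereal Pr f <= Ereal Pr g.
Proof. by move=> hf hg fg; apply: le_Rintegral => // w _; exact: fg. Qed.

Lemma normc_ge_Im (x : C) : `|complex.Im x|%:C <= `|x|.
Proof. by have := normc_ge_Re (x * 'i); rewrite ReiNIm normrN normrM normCi mulr1. Qed.

Section Dominated.
Variable g : T -> R.
Hypothesis g_int : rintegrable g.

Lemma dominated_integrable m n (X : T -> 'M[C]_(m, n)) i j : dominated g X ->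
  rintegrable (fun w => complex.Re (X w i j)) /\ rintegrable (fun w => complex.Im (X w i j)).
Proof.
move=> [mX [k hX]]; split; (apply: (rintegrable_dom (g := fun w => k * g w)); last exact: rintegrableZ).
- exact: (mX i j).1.
- by move=> w; rewrite -lecR (le_trans (normc_ge_Re _)).
- exact: (mX i j).2.
- by move=> w; rewrite -lecR (le_trans (normc_ge_Im _)).
Qed.

(** Real-linear in the real and imaginary parts of the entries of [G], which is the form in which
    the entrywise [Emx] passes through the trace. *)
Lemma Re_tr_mulE n p (G : 'M[C]_(n, p)) (X : 'M[C]_(p, n)) : complex.Re (\tr (G *m X)) =
  \sum_i \sum_j (complex.Re (X j i) * complex.Re (G i j) + - complex.Im (X j i) * complex.Im (G i j)).
Proof.
rewrite /mxtrace Re_sum; apply: eq_bigr => i _; rewrite mxE Re_sum; apply: eq_bigr => j _.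
by case: (G i j) => a b; case: (X j i) => u v /=; ring.
Qed.

Lemma rintegrable_tr n p (G : T -> 'M[C]_(n, p)) (X : 'M[C]_(p, n)) : dominated g G ->
  rintegrable (fun w => complex.Re (\tr (G w *m X))).
Proof.
move=> hG; under eq_fun do rewrite Re_tr_mulE.
apply: rintegrable_sum => i; apply: rintegrable_sum => j.
by have [hr hi] := dominated_integrable i j hG; apply: rintegrableD; exact: rintegrableZ.
Qed.

Lemma Ereal_tr n p (G : T -> 'M[C]_(n, p)) (X : 'M[C]_(p, n)) : dominated g G ->
  Ereal Pr (fun w => complex.Re (\tr (G w *m X))) = complex.Re (\tr (Emx Pr G *m X)).
Proof.
move=> hG; under eq_fun do rewrite Re_tr_mulE.
have hij i j := dominated_integrable i j hG.
rewrite Re_tr_mulE Ereal_sum => [|i]; last first.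
  by apply: rintegrable_sum => j; have [? ?] := hij i j; apply: rintegrableD; exact: rintegrableZ.
apply: eq_bigr => i _; rewrite Ereal_sum => [|j]; last first.
  by have [? ?] := hij i j; apply: rintegrableD; exact: rintegrableZ.
apply: eq_bigr => j _; have [hr hi] := hij i j.
by rewrite ErealD ?ErealZ ?mxE //; exact: rintegrableZ.
Qed.

Lemma ctmx_Emx n (G : T -> 'M[C]_n) : dominated g G -> (forall w, ctmx (G w) = G w) ->
  ctmx (Emx Pr G) = Emx Pr G.
Proof.
move=> hG hG'; apply/matrixP => i j; rewrite ctmxE !mxE /=.
have e w : G w i j = conjc (G w j i) by rewrite -ctmxE hG'.
congr (_ +i* _); first by congr Ereal; apply/funext => w; rewrite e Re_conjc.
rewrite -mulN1r -ErealZ; last exact: (dominated_integrable j i hG).2.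
by congr Ereal; apply/funext => w; rewrite e mulN1r; case: (G w j i).
Qed.

(** Applying [ln_det_le_tr] to X and to X^-1 gives n - tr X^-1 <= ln det X <= tr X - n, both sides
    being integrable. *)
Lemma rintegrable_ln_det n (X : T -> 'M[C]_n) : (forall w, pdmx (X w)) ->
  dominated g X -> dominated g (fun w => invmx (X w)) ->
  rintegrable (fun w => ln (complex.Re (\det (X w)))).
Proof.
move=> pX hX hXi.
pose h w := `|complex.Re (\tr (X w *m 1%:M))| + `|complex.Re (\tr (invmx (X w) *m 1%:M))| + n%:R.
have hint f : rintegrable f -> rintegrable (fun w => `|f w|).
  by move=> hf; have := integrable_norm hf.
apply: (rintegrable_dom (g := h)).
- apply: measurableT_comp; first exact: measurable_ln.
  exact: (cmeasurable_det hX.1).1.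
- move=> w; rewrite /h !mulmx1; have := ln_det_le_tr (pX w).
  have := ln_det_le_tr (pdmx_inv (pX w)); rewrite det_inv.
  have dX := pdmx_Re_det_gt0 (pX w).
  rewrite -[\det (X w)]ge0_ReK; last exact/ltW/pdmx_det_gt0.
  rewrite -fmorphV /= lnV ?posrE // => h1 h2.
  have := ler_norm (complex.Re (\tr (X w))); have := ler_norm (complex.Re (\tr (invmx (X w)))).
  have := normr_ge0 (complex.Re (\tr (X w))); have := normr_ge0 (complex.Re (\tr (invmx (X w)))).
  have n0 : 0 <= n%:R :> R by [].
  by move=> *; rewrite ler_norml; apply/andP; split; lra.
- apply: rintegrableD; last exact: rintegrable_cst.
  by apply: rintegrableD; apply: hint; exact: rintegrable_tr.
Qed.

End Dominated.
End Expectation.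

(** * Perturbation of the rates *)

Lemma sum_split3 (V : zmodType) (L : nat) (l : 'I_L) (f : 'I_L -> V) :
  \sum_t f t = \sum_(t < L | (t < l)%N) f t + f l + \sum_(t < L | (l < t)%N) f t.
Proof.
rewrite (bigID (fun t : 'I_L => (t < l)%N)) /= -addrA; congr (_ + _).
rewrite (bigD1 l) ?ltnn //=; congr (_ + _).
by apply: eq_bigl => t; rewrite -leqNgt [RHS]ltn_neqAle andbC eq_sym.
Qed.

Section Channel.
Context {R : realType} {d : measure_display} {T : measurableType d} (Pr : probability T R).
Local Notation C := R[i].
Variables (Nt Nr L : nat) (N0 : R) (H : 'I_L -> T -> 'M[C]_(Nr, Nt)).
Hypothesis N0_gt0 : 0 < N0.
Hypothesis H_random : forall l, random_matrix (H l).
Hypothesis H_power : forall l,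
  (\int[Pr]_w (complex.Re (\tr (H l w *m ctmx (H l w))))%:E < +oo)%E.

(** The summand 1 lets one integrable envelope cover bounded matrices as well as those of order
    |H|^2. *)
Definition gauge l w : R := 1 + complex.Re (\tr (H l w *m ctmx (H l w))).

Lemma gauge_ge1 l w : 0 <= (1 : R) <= gauge l w.
Proof. by rewrite ler01 lerDl; apply/Re_ge0/tr_mul_ctmx_ge0. Qed.

Lemma gauge_integrable l : rintegrable Pr (gauge l).
Proof.
apply: rintegrableD; first exact: rintegrable_cst.
apply/integrableP; split.
  apply/measurable_EFinP; have := cmeasurable_sum; rewrite /mxtrace.
  move=> /(_ R d T 'I_Nr (index_enum 'I_Nr) (fun i w => (H l w *m ctmx (H l w)) i i)) h.
  apply: (h _).1 => i; suff : random_matrix (fun w => H l w *m ctmx (H l w)) by apply.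
  by apply: random_matrixM; [exact: H_random|exact/random_matrix_ct/H_random].
under eq_integral => w _.
  rewrite /= ger0_norm; last exact/Re_ge0/tr_mul_ctmx_ge0.
  over.
exact: H_power.
Qed.

Section Design.
Variables (F P : 'I_L -> 'M[C]_Nt).
Hypothesis P_unit : forall l, P l \in unitmx.
Local Notation Sig := (covs P).

Lemma SigS_psd l : psdmx (SigS Sig l).
Proof. by apply: psdmx_sum => t; exact: psdmx_gram. Qed.

Lemma SigI_psd l : psdmx (SigI Sig l).
Proof. by apply: psdmx_sum => t; exact: psdmx_gram. Qed.

Lemma SigU_pd l Hm : pdmx (SigU (Nr := Nr) N0 F Sig l Hm).
Proof. exact: (condcov_pd (F l) Hm N0_gt0 (SigS_psd l) (SigI_psd l) (P_unit l) erefl). Qed.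

Lemma Kinv_random l : random_matrix (fun w => Kinv N0 Sig l (H l w)).
Proof.
apply: random_matrix_inv.
  by move=> w; apply: pdmx_unit;
    exact: (outcov_pd (H l w) N0_gt0 (SigS_psd l) (SigI_psd l) (P_unit l) erefl).
have mH := H_random l.
apply: random_matrixD.
  apply: random_matrixM; last exact: random_matrix_ct.
  by apply: random_matrixM => //; exact: random_matrix_cst.
apply: random_matrixD; last exact: random_matrix_cst.
apply: random_matrixM; last exact: random_matrix_ct.
by apply: random_matrixM => //; exact: random_matrix_cst.
Qed.

Lemma Tmx_dominated l : dominated (fun=> 1) (fun w => Tmx N0 F Sig l (H l w)).
Proof.
pose M w := ctmx (H l w) *m Kinv N0 Sig l (H l w) *m H l w.
have -> : (fun w => Tmx N0 F Sig l (H l w)) = (fun w => Amx F Sig l *m M w).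
  by apply/funext => w; rewrite /Tmx /M !mulmxA.
apply: dominated_mulr; first exact: dominated_cst.
split.
  apply: random_matrixM => //; apply: random_matrixM; first exact/random_matrix_ct.
  exact: Kinv_random.
exists (complex.Re (\tr (invmx (P l) *m ctmx (invmx (P l))))) => w i j.
rewrite mulr1 ge0_ReK ?tr_mul_ctmx_ge0 //.
exact: (gainmx_entry_le (H l w) N0_gt0 (SigS_psd l) (SigI_psd l) (P_unit l) erefl).
Qed.

Lemma dominated_gauge l m n (X : T -> 'M[C]_(m, n)) :
  dominated (fun=> 1) X -> dominated (gauge l) X.
Proof. by apply: dominated_le => w; exact: gauge_ge1. Qed.

Lemma SigU_dominated l : dominated (fun=> 1) (fun w => SigU N0 F Sig l (H l w)).
Proof.
apply: dominatedB; first exact: dominated_cst.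
by apply: dominated_mulr; [exact: Tmx_dominated|exact: dominated_cst].
Qed.

Lemma SigU_inv_dominated l : dominated (gauge l) (fun w => invmx (SigU N0 F Sig l (H l w))).
Proof.
split.
  apply: random_matrix_inv; last by case: (SigU_dominated l).
  by move=> w; apply: pdmx_unit; exact: SigU_pd.
pose a := complex.Re (\tr (invmx (P l) *m ctmx (invmx (P l)))).
exists (a + N0^-1) => w i j.
apply: le_trans (inv_condcov_entry_le (F l) (H l w) N0_gt0 (SigS_psd l) (SigI_psd l) (P_unit l) erefl i j) _.
rewrite /condcov_bound -[\tr (invmx _ *m _)]ge0_ReK ?tr_mul_ctmx_ge0 // -/a.
rewrite -[\tr (H l w *m _)]ge0_ReK ?tr_mul_ctmx_ge0 // -rmorphM -rmorphD /= lecR /gauge.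
set b := complex.Re _; have b0 : 0 <= b by apply/Re_ge0/tr_mul_ctmx_ge0.
have a0 : 0 <= a by apply/Re_ge0/tr_mul_ctmx_ge0.
have N0i : 0 <= N0^-1 by rewrite invr_ge0 ltW.
by have := mulr_ge0 a0 b0; rewrite mulrDr mulr1 mulrDl; lra.
Qed.

Lemma ln_det_SigU_integrable l :
  rintegrable Pr (fun w => ln (complex.Re (\det (SigU N0 F Sig l (H l w))))).
Proof.
apply: (rintegrable_ln_det (gauge_integrable l)); first by move=> w; exact: SigU_pd.
- exact/dominated_gauge/SigU_dominated.
- exact: SigU_inv_dominated.
Qed.

(* G3, G2, G1 arise as B^H S B with B = F - T, 1 - T, T according to the position of t. *)
Definition Bsel (l t : 'I_L) Hm : 'M[C]_Nt :=
  if (t < l)%N then F l - Tmx (Nr := Nr) N0 F Sig l Hm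
  else if t == l then 1%:M - Tmx N0 F Sig l Hm else Tmx N0 F Sig l Hm.

Definition Gsel (l t : 'I_L) Hm : 'M[C]_Nt :=
  ctmx (Bsel l t Hm) *m invmx (SigU N0 F Sig l Hm) *m Bsel l t Hm.

Lemma Gsel_dominated l t : dominated (gauge l) (fun w => Gsel l t (H l w)).
Proof.
have hB : dominated (fun=> 1) (fun w => Bsel l t (H l w)).
  rewrite /Bsel; have hT := Tmx_dominated l.
  by case: (t < l)%N; [|case: (t == l) => //]; apply: dominatedB => //; exact: dominated_cst.
apply: dominated_mulr => //; apply: dominated_mull; last exact: SigU_inv_dominated.
exact: dominated_ct.
Qed.

Lemma Gsel_herm l t Hm : ctmx (Gsel l t Hm) = Gsel l t Hm.
Proof.
have [hS _] := pdmx_inv (SigU_pd l Hm).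
by rewrite /Gsel !ctmxM ctmxK hS mulmxA.
Qed.

Lemma GselE l t Hm : Gsel l t Hm =
  if (t < l)%N then G3 N0 F Sig l Hm else if t == l then G2 N0 F Sig l Hm
  else G1 N0 F Sig l Hm.
Proof.
rewrite /Gsel /Bsel /G1 /G2 /G3.
set S := invmx _; set Tl := Tmx _ _ _ _ _.
case: ifP => _; [|case: eqP => _ //]; rewrite /=; clearbody S Tl; mx_expand; mx_entrywise.
Qed.

(* The estimator W is the LMMSE filter of the unperturbed design: it is suboptimal
   for the design (F', P'), so its error covariance dominates the conditional one. *)
Lemma ln_det_SigU_le F' P' l (Hm : 'M[C]_(Nr, Nt)) : (forall t, P' t \in unitmx) ->
  ln (complex.Re (\det (SigU N0 F' (covs P') l Hm))) <=
  ln (complex.Re (\det (SigU N0 F Sig l Hm))) +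
  complex.Re (\tr (invmx (SigU N0 F Sig l Hm) *m
    ((F' l - Tmx N0 F Sig l Hm) *m SigS (covs P') l *m ctmx (F' l - Tmx N0 F Sig l Hm)
     - (F l - Tmx N0 F Sig l Hm) *m SigS Sig l *m ctmx (F l - Tmx N0 F Sig l Hm)
     + (1%:M - Tmx N0 F Sig l Hm) *m (covs P' l - Sig l) *m ctmx (1%:M - Tmx N0 F Sig l Hm)
     + Tmx N0 F Sig l Hm *m (SigI (covs P') l - SigI Sig l) *m ctmx (Tmx N0 F Sig l Hm)))).
Proof.
move=> P'_unit; set Tl := Tmx _ F _ _ _.
pose W := lmmse N0 (F l) (SigS Sig l) (Sig l) (SigI Sig l) Hm.
have S'_psd : psdmx (SigS (covs P') l) by apply: psdmx_sum => t; exact: psdmx_gram.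
have I'_psd : psdmx (SigI (covs P') l) by apply: psdmx_sum => t; exact: psdmx_gram.
have pX' := condcov_pd (F' l) Hm N0_gt0 S'_psd I'_psd (P'_unit l) erefl.
have pE := errcov_ge (F' l) Hm N0_gt0 S'_psd I'_psd (P'_unit l) erefl W.
apply: le_trans (ln_det_tangent pX' (SigU_pd l Hm) pE) _.
rewrite lerD2l le_eqVlt; apply/orP; left; apply/eqP; congr (complex.Re (\tr (_ *m _))).
rewrite -[SigU N0 F Sig l Hm](errcov_lmmse (F l) Hm N0_gt0 (SigS_psd l) (SigI_psd l) (P_unit l) erefl).
(* The noise term N0 W W^H depends on the filter only, so it cancels in the difference; elsewhere W
   enters through [W *m Hm], which is [Tl]. *)
rewrite /errcov -/W -[W *m Hm]/Tl; clearbody W Tl.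
move: (F' l - Tl) (F l - Tl) (1%:M - Tl) => a b c.
rewrite !(mulmxBr _ (covs _ _)) !(mulmxBr _ (SigI _ _)) !mulmxBl; mx_entrywise.
Qed.


Lemma Ereal_log2det (X : T -> 'M[C]_Nt) :
  rintegrable Pr (fun w => ln (complex.Re (\det (X w)))) ->
  Ereal Pr (fun w => log2det (X w)) =
  (ln 2)^-1 * Ereal Pr (fun w => ln (complex.Re (\det (X w)))).
Proof.
move=> hX; rewrite -ErealZ //; congr Ereal; apply/funext => w.
by rewrite /log2det /log2 mulrC.
Qed.

End Design.

Lemma log2det_gap_le (A A' : 'M[C]_Nt) (X X' : T -> 'M[C]_Nt) (h : T -> R) :
  rintegrable Pr (fun w => ln (complex.Re (\det (X w)))) ->
  rintegrable Pr (fun w => ln (complex.Re (\det (X' w)))) -> rintegrable Pr h ->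
  (forall w, ln (complex.Re (\det (X' w))) <= ln (complex.Re (\det (X w))) + h w) ->
  log2det A - Ereal Pr (fun w => log2det (X w)) + (ln 2)^-1 *
    (ln (complex.Re (\det A')) - ln (complex.Re (\det A)) - Ereal Pr h)
  <= log2det A' - Ereal Pr (fun w => log2det (X' w)).
Proof.
move=> i1 i2 hint hle; have le_E := le_Ereal i2 (rintegrableD i1 hint) hle.
rewrite !Ereal_log2det // /log2det /log2; move: le_E; rewrite ErealD //.
have : 0 < (ln 2 : R)^-1 by rewrite invr_gt0 ln_gt0 // ltr1n.
set c := (ln 2)^-1; set x := Ereal _ _; set y := Ereal _ _; set z := Ereal _ h.
by move=> c0 /(ler_wpM2l (ltW c0)); rewrite mulrDr; lra.
Qed.

Lemma rate_ge_of_SigU_le F P F' P' l (h : T -> R) :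
  (forall t, P t \in unitmx) -> (forall t, P' t \in unitmx) -> rintegrable Pr h ->
  (forall w, ln (complex.Re (\det (SigU N0 F' (covs P') l (H l w)))) <=
             ln (complex.Re (\det (SigU N0 F (covs P) l (H l w)))) + h w) ->
  rate Pr N0 F (covs P) H l + (ln 2)^-1 *
    (ln (complex.Re (\det (covs P' l))) - ln (complex.Re (\det (covs P l))) - Ereal Pr h)
  <= rate Pr N0 F' (covs P') H l.
Proof.
move=> uP uP' hint hle.
apply: log2det_gap_le hint hle; exact: ln_det_SigU_integrable.
Qed.

Section Perturbation.
Variables (F P : 'I_L -> 'M[C]_Nt).
Hypothesis P_unit : forall l, P l \in unitmx.
Local Notation Sig := (covs P).

(** With F and the filter fixed, the error covariance is affine in the covariances. The increment of
    each one is multiplied by [Bsel] on both sides, and cyclicity of the trace gathers these factors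
    into [Gsel]. *)
Lemma rate_ge_precoder P' l : (forall t, P' t \in unitmx) ->
  rate Pr N0 F Sig H l + (ln 2)^-1 *
    (ln (complex.Re (\det (covs P' l))) - ln (complex.Re (\det (Sig l)))
     - \sum_t complex.Re (\tr (Emx Pr (fun w => Gsel F P l t (H l w)) *m (covs P' t - Sig t))))
  <= rate Pr N0 F (covs P') H l.
Proof.
move=> P'_unit.
pose h t w := complex.Re (\tr (Gsel F P l t (H l w) *m (covs P' t - Sig t))).
have hint t : rintegrable Pr (h t).
  exact: (rintegrable_tr (gauge_integrable l) _ (Gsel_dominated F P_unit l t)).
have -> : \sum_t complex.Re (\tr (Emx Pr (fun w => Gsel F P l t (H l w)) *m (covs P' t - Sig t)))
    = Ereal Pr (fun w => \sum_t h t w).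
  rewrite Ereal_sum //; apply: eq_bigr => t _.
  by rewrite (Ereal_tr (gauge_integrable l) _ (Gsel_dominated F P_unit l t)).
apply: rate_ge_of_SigU_le => // [|w]; first exact: rintegrable_sum.
apply: le_trans (ln_det_SigU_le F P_unit F l (H l w) P'_unit) _.
rewrite lerD2l le_eqVlt; apply/orP; left; apply/eqP.
rewrite /h -Re_sum; congr (complex.Re _).
set Tl := Tmx _ _ _ _ _; set S := invmx _.
have trE t : \tr (Gsel F P l t (H l w) *m (covs P' t - Sig t)) =
    \tr (S *m (Bsel F P l t (H l w) *m (covs P' t - Sig t) *m ctmx (Bsel F P l t (H l w)))).
  by rewrite /Gsel -!mulmxA mxtrace_mulC !mulmxA.
under eq_bigr do rewrite trE.
rewrite -raddf_sum -mulmx_sumr; congr (\tr (_ *m _)).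
rewrite (sum_split3 l) /= -!mulmxBl -mulmxBr.
apply: f_equal2; first apply: f_equal2.
- rewrite /SigS -sumrB mulmx_sumr mulmx_suml; apply: eq_bigr => t tl.
  by rewrite /Bsel tl.
- by rewrite /Bsel ltnn eqxx.
- rewrite /SigI -sumrB mulmx_sumr mulmx_suml; apply: eq_bigr => t tl.
  by rewrite /Bsel ltnNge (ltnW tl) /= -val_eqE gtn_eqF.
Qed.

Lemma Re_tr_quadratic (S X1 X2 X3 : 'M[C]_Nt) (s : R) :
  complex.Re (\tr (S *m (s%:C *: X1 + s%:C *: X2 + (s ^+ 2)%:C *: X3))) =
  s * complex.Re (\tr (S *m X1)) + s * complex.Re (\tr (S *m X2))
  + s ^+ 2 * complex.Re (\tr (S *m X3)).
Proof.
rewrite !mulmxDr -!scalemxAr !mxtraceD !mxtraceZ.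
by move: (\tr _) (\tr _) (\tr _) => x y z; rewrite !ReD !ReZ.
Qed.

(** [F'] is constrained at [l] only, because the rate of receiver l involves no other inflation
    matrix. *)
Lemma rate_ge_inflation F' (D : 'M[C]_Nt) (s : R) l : F' l = F l + s%:C *: D ->
  rate Pr N0 F Sig H l - (ln 2)^-1 *
    (2 * s * trip D (Emx Pr (fun w => invmx (SigU N0 F Sig l (H l w))
                       *m (F l - Tmx N0 F Sig l (H l w)) *m SigS Sig l))
     + s ^+ 2 * complex.Re (\tr (Emx Pr (fun w => invmx (SigU N0 F Sig l (H l w)))
                       *m (D *m SigS Sig l *m ctmx D))))
  <= rate Pr N0 F' Sig H l.
Proof.
move=> F'E; set Phi := fun w : T => _ *m SigS Sig l; set S := fun w : T => invmx _.
have gi := gauge_integrable l.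
have dS : dominated (gauge l) S by exact: SigU_inv_dominated.
have dPhi : dominated (gauge l) Phi.
  apply: dominated_mulr; last exact: dominated_cst.
  apply: dominated_mulr => //; apply: dominatedB; [exact: dominated_cst|exact: Tmx_dominated].
pose h1 w := complex.Re (\tr (Phi w *m ctmx D)).
pose h2 w := complex.Re (\tr (S w *m (D *m SigS Sig l *m ctmx D))).
have i1 : rintegrable Pr h1 by exact: (rintegrable_tr gi).
have i2 : rintegrable Pr h2 by exact: (rintegrable_tr gi).
pose h w := 2 * s * h1 w + s ^+ 2 * h2 w.
have hint : rintegrable Pr h by apply: rintegrableD; exact: rintegrableZ.
have hE : Ereal Pr h = 2 * s * trip D (Emx Pr Phi)
    + s ^+ 2 * complex.Re (\tr (Emx Pr S *m (D *m SigS Sig l *m ctmx D))).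
  have e1 : Ereal Pr h1 = trip D (Emx Pr Phi).
    by rewrite (Ereal_tr gi (ctmx D) dPhi) /trip mxtrace_mulC.
  have e2 : Ereal Pr h2 = complex.Re (\tr (Emx Pr S *m (D *m SigS Sig l *m ctmx D))).
    exact: (Ereal_tr gi _ dS).
  apply: etrans (ErealD (rintegrableZ _ i1) (rintegrableZ _ i2)) _.
  by congr (_ + _); [rewrite -e1|rewrite -e2]; exact: ErealZ.
have := @rate_ge_of_SigU_le F P F' P l h P_unit P_unit hint.
rewrite hE subrr sub0r mulrN; apply=> w.
apply: le_trans (ln_det_SigU_le F P_unit F' l (H l w) P_unit) _.
rewrite lerD2l le_eqVlt; apply/orP; left; apply/eqP; rewrite !subrr F'E.
rewrite mulmx0 !mulmx0 !mul0mx !addr0 /h /h1 /h2 /Phi -/(S w).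
have [hSS _] := SigS_psd P l.
have hS : ctmx (S w) = S w by exact: (pdmx_inv (SigU_pd F P_unit l (H l w))).1.
move: (Tmx _ _ _ _ _) (S w) hS => Tl Sw hS.
(* The two cross terms of the expansion have the same real trace, since S and [SigS] are Hermitian;
   this is the factor 2 of the linear term. *)
have trE : complex.Re (\tr (Sw *m (D *m SigS Sig l *m ctmx (F l - Tl)))) =
    complex.Re (\tr (Sw *m (F l - Tl) *m SigS Sig l *m ctmx D)).
  by rewrite -Re_conjc -mxtrace_ctmx !ctmxM ctmxK hS hSS mxtrace_mulC !mulmxA.
have -> : F l + s%:C *: D - Tl = (F l - Tl) + s%:C *: D by rewrite addrAC.
move: trE; move: (F l - Tl) => B trE.
have -> : (B + s%:C *: D) *m SigS Sig l *m ctmx (B + s%:C *: D) - B *m SigS Sig l *m ctmx B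
  = s%:C *: (D *m SigS Sig l *m ctmx B) + s%:C *: (B *m SigS Sig l *m ctmx D)
    + (s ^+ 2)%:C *: (D *m SigS Sig l *m ctmx D).
  rewrite ctmxD ctmxZ conjc_real !mulmxDl !mulmxDr ?mulmxDl.
  rewrite -?scalemxAl -?scalemxAr -?scalemxAl -?scalemxAr.
  by rewrite rmorphXn /=; mx_entrywise.
have BE : Sw *m (B *m SigS Sig l *m ctmx D) = Sw *m B *m SigS Sig l *m ctmx D.
  by rewrite !mulmxA.
apply: etrans (Re_tr_quadratic _ _ _ _ _) _.
rewrite [X in s * X + _ + _]trE [X in _ + s * complex.Re (\tr X) + _]BE.
by congr (_ + _); rewrite -mulrA mulrDl mul1r.
Qed.

End Perturbation.
End Channel.

(** * First-order conditions *)

Section DetExpansion.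
Context {R : realType}.
Local Notation C := R[i].

Lemma horner_char_poly n (A : 'M[C]_n) a : (char_poly A).[a] = \det (a%:M - A).
Proof.
rewrite -horner_evalE -det_map_mx; congr (\det _); apply/matrixP => i j.
by rewrite !mxE /= /horner_eval hornerD hornerN hornerMn hornerX hornerC.
Qed.

(* det (1 + s X) = s^n q(1/s), where q is the characteristic polynomial of -X, whose two
   leading coefficients are 1 and tr X. *)
Lemma det_1DZ n (X : 'M[C]_n) : (0 < n)%N -> exists2 c : R, 0 <= c &
  forall s : R, 0 < s <= 1 ->
    `|\det (1%:M + s%:C *: X) - 1 - s%:C * \tr X| <= (c * s ^+ 2)%:C.
Proof.
case: n X => // m X _; set q := char_poly (- X).
have qm1 : q`_m.+1 = 1.
  by have /monicP := char_poly_monic (- X); rewrite lead_coefE size_char_poly.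
have qm : q`_m = \tr X by rewrite [q`_m]char_poly_trace // raddfN /= opprK.
(* The coefficients below the two leading ones come with powers s^k, k >= 2, each at most s^2 for s
   <= 1. *)
exists (complex.Re (\sum_(i < m) `|q`_i|)) => [|s /andP[s0 s1]].
  by apply/Re_ge0/sumr_ge0.
have sC0 : s%:C != 0 :> C by rewrite -(rmorph0 (real_complex R)) (inj_eq (@complexI _)) gt_eqF.
have -> : 1%:M + s%:C *: X = s%:C *: ((s%:C^-1)%:M - (- X)).
  by rewrite opprK scalerDr scale_scalar_mx divff.
rewrite detZ -horner_char_poly -/q horner_coef size_char_poly big_ord_recr big_ord_recr /=.
rewrite qm qm1 mul1r.
have -> : s%:C ^+ m.+1 * (\sum_(i < m) q`_i * s%:C^-1 ^+ i + \tr X * s%:C^-1 ^+ m + s%:C^-1 ^+ m.+1)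
   - 1 - s%:C * \tr X = \sum_(i < m) q`_i * s%:C ^+ (m.+1 - i).
  have sV k : (k <= m.+1)%N -> s%:C ^+ m.+1 * s%:C^-1 ^+ k = s%:C ^+ (m.+1 - k).
    by move=> km; rewrite exprVn -{1}(subnK km) exprD mulfK // expf_neq0.
  rewrite !mulrDr mulr_sumr sV // subnn expr0 mulrCA sV // subSnn expr1.
  under eq_bigr => i _ do rewrite mulrCA sV ?leqW ?(ltnW (ltn_ord i)) //.
  by move: (\sum_(i < m) _) (\tr X) => x y; ring.
apply: le_trans (ler_norm_sum _ _ _) _.
rewrite rmorphM /= ge0_ReK; last exact/sumr_ge0.
rewrite mulr_suml; apply: ler_sum => i _; rewrite normrM ler_wpM2l //.
have sC : 0 <= s%:C :> C by rewrite lecR ltW.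
rewrite ger0_norm ?exprn_ge0 // -rmorphXn lecR.
rewrite -(subnKC (_ : 2 <= m.+1 - i)%N); last first.
  by rewrite subSn ?(ltnW (ltn_ord i)) // ltnS subn_gt0.
by rewrite exprD ler_piMr ?exprn_ge0 ?exprn_ile1 // ltW.
Qed.

(** The inequality ln v <= v - 1 at v = 1 / (1 + u) gives ln(1 + u) >= u - u^2 v, and v <= 2 on this
    range. *)
Lemma ln1D_ge (u : R) : `|u| <= 1 / 2 -> u - 2 * u ^+ 2 <= ln (1 + u).
Proof.
rewrite ler_norml => /andP[u1 u2]; have p : 0 < 1 + u by lra.
have vp : 0 < (1 + u)^-1 by rewrite invr_gt0.
have := ln_le_subr1 vp; rewrite lnV ?posrE //.
have e : (1 + u)^-1 * (1 + u) = 1 by rewrite mulVf // gt_eqF.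
have v2 : (1 + u)^-1 <= 2 by rewrite -[2]invrK lef_pV2 ?posrE ?invr_gt0 //; lra.
move: vp e v2; set v := (1 + u)^-1 => vp e v2 h.
have : u ^+ 2 * v <= u ^+ 2 * 2 by rewrite ler_wpM2l // sqr_ge0.
have uv : u * v = 1 - v by rewrite -e; ring.
have -> : u ^+ 2 * v = u - 1 + v by rewrite expr2 -mulrA uv mulrBr mulr1 uv; ring.
by lra.
Qed.

(** Writing P + sD = P (1 + s P^-1 D) leaves ln |z|^2 with z = det(1 + s P^-1 D). Here |z| >= Re z
    >= 1 + u with u = s t - c s^2, which is positive for small s and so gives invertibility too. *)
Lemma ln_det_gram_ge n (P D : 'M[C]_n) : (0 < n)%N -> P \in unitmx ->
  exists c e : R, 0 < e /\ forall s : R, 0 < s < e ->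
    P + s%:C *: D \in unitmx /\
    2 * s * trip D (invmx (ctmx P)) - c * s ^+ 2 <=
    ln (complex.Re (\det ((P + s%:C *: D) *m ctmx (P + s%:C *: D))))
    - ln (complex.Re (\det (P *m ctmx P))).
Proof.
move=> n0 uP; set X := invmx P *m D; have [c c0 hc] := det_1DZ X n0.
set t := complex.Re (\tr X).
have tE : trip D (invmx (ctmx P)) = t.
  by rewrite tripC /trip -ctmx_inv ctmxK.
(* [K] gives |u| <= s K for s <= 1, and s < 1 / (2K) puts u in the range of [ln1D_ge]. The constant
   below is then read off 2u - 4u^2 >= 2u - 4 K^2 s^2. *)
pose K := `|t| + c + 1.
have t0 : 0 <= `|t| by [].
have K0 : 0 < K by rewrite /K; lra.
exists (2 * (c + 2 * K ^+ 2)), (Num.min 1 (2 * K)^-1); split.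
  by rewrite lt_min ltr01 invr_gt0 mulr_gt0.
move=> s /andP[s0]; rewrite lt_min => /andP[s1 sK].
have sK2 : s * K <= 1 / 2.
  have : s * (2 * K) <= (2 * K)^-1 * (2 * K) by rewrite ler_wpM2r ?mulr_ge0 // ltW.
  by rewrite mulVf ?gt_eqF ?mulr_gt0 //; lra.
have PE : P + s%:C *: D = P *m (1%:M + s%:C *: X).
  by rewrite mulmxDr mulmx1 -scalemxAr /X mulmxA mulmxV // mul1mx.
set z := \det (1%:M + s%:C *: X).
have := hc s; rewrite s0 ltW // => /(_ isT) hz.
pose u := s * t - c * s ^+ 2.
have zu : 1 + u <= complex.Re z.
  have := le_trans (normc_ge_Re _) hz; rewrite lecR -/z ler_norml => /andP[h _].
  move: h; rewrite !ReB ReZ -/t /u /=; lra.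
have uK : `|u| <= s * K.
  rewrite /u; apply: le_trans (ler_normB _ _) _.
  rewrite !normrM (gtr0_norm s0) (ger0_norm c0) -expr2.
  have : c * s ^+ 2 <= s * c by rewrite expr2 mulrA [s * c]mulrC ler_piMr ?mulr_ge0 // ltW.
  by rewrite /K !mulrDr; lra.
have u12 := le_trans uK sK2.
have u1 : 0 < 1 + u by move: u12; rewrite ler_norml => /andP[? ?]; lra.
have z0 : z != 0.
  by apply/eqP => z0; move: zu; rewrite z0 /=; lra.
have dP : \det P != 0 by move: uP; rewrite unitmxE unitfE.
split; first by rewrite PE unitmx_mul uP unitmxE unitfE.
rewrite tE PE !det_gram det_mulmx -/z normrM exprMn.
have normE (y : C) : `|y| ^+ 2 = (complex.Re y ^+ 2 + complex.Im y ^+ 2)%:C.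
  by rewrite add_Re2_Im2.
have pos (y : C) : y != 0 -> 0 < complex.Re y ^+ 2 + complex.Im y ^+ 2.
  by move=> y0; rewrite -ltcR -normE exprn_gt0 // normr_gt0.
rewrite !normE -rmorphM /= lnM ?posrE ?pos // [ln _ + ln _]addrC addrK.
have lnu := ln1D_ge u12.
have lnz : 2 * ln (1 + u) <= ln (complex.Re z ^+ 2 + complex.Im z ^+ 2).
  have -> : 2 * ln (1 + u) = ln ((1 + u) ^+ 2) by rewrite lnXn // mulr_natl.
  rewrite ler_ln ?posrE ?exprn_gt0 ?pos //.
  have sq : (1 + u) ^+ 2 <= complex.Re z ^+ 2.
    by rewrite ler_sqr // nnegrE ?(le_trans (ltW u1) zu) // ltW.
  by apply: le_trans sq _; rewrite lerDl sqr_ge0.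
apply: le_trans lnz.
have u2 : u ^+ 2 <= K ^+ 2 * s ^+ 2.
  have := ler_pM (normr_ge0 u) (normr_ge0 u) uK uK.
  by rewrite -normrM -!expr2 ger0_norm ?sqr_ge0 // exprMn mulrC.
have uE : u = s * t - c * s ^+ 2 by [].
move: lnu u2 uE; move: (ln (1 + u)) => y; clearbody u; move: (u ^+ 2) => v lnu u2 uE.
have -> : 2 * s * t - 2 * (c + 2 * K ^+ 2) * s ^+ 2 = 2 * u - 4 * (K ^+ 2 * s ^+ 2).
  by rewrite uE; ring.
by move: lnu u2; lra.
Qed.

(** The substitute for a one-sided derivative: it extracts the first-order coefficient from
    inequalities at finite steps. *)
Lemma le0_of_quadratic (a b e : R) : 0 < e ->
  (forall s, 0 < s < e -> a * s - b * s ^+ 2 <= 0) -> a <= 0.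
Proof.
move=> e0 h; rewrite leNgt; apply/negP => a0.
pose K := `|b| + 1; have b0 : 0 <= `|b| by [].
have K0 : 0 < K by rewrite /K; lra.
pose s := Num.min (e / 2) (a / K / 2).
have s0 : 0 < s by rewrite lt_min !divr_gt0.
have se : s < e by rewrite gt_min; apply/orP; left; lra.
have sK : s * K < a.
  have : s * K <= a / K / 2 * K by rewrite ler_wpM2r ?ge_min ?lexx ?orbT // ltW.
  by rewrite mulrAC divfK ?gt_eqF //; lra.
have := h s; rewrite s0 se => /(_ isT).
have : 0 < s * (a - s * K) by rewrite mulr_gt0 // subr_gt0.
have : b * s ^+ 2 <= K * s ^+ 2.
  by rewrite ler_wpM2r ?sqr_ge0 // /K (le_trans (ler_norm b)) // lerDl.
by rewrite expr2; lra.
Qed.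
End DetExpansion.

(** * The multiplier for a single power constraint *)

Section KKT.
Context {R : realType}.
Local Notation C := R[i].
Variables (L n : nat).
Implicit Types X Y Z : 'I_L -> 'M[C]_n.

Definition ip X Y : R := \sum_t trip (X t) (Y t).

Lemma ipC X Y : ip X Y = ip Y X.
Proof. by apply: eq_bigr => t _; exact: tripC. Qed.

Lemma ip_lin X Y Z (a : R) : ip (fun t => X t + a%:C *: Y t) Z = ip X Z + a * ip Y Z.
Proof.
by rewrite /ip mulr_sumr -big_split; apply: eq_bigr => t _; rewrite /= tripDl tripZl.
Qed.

Lemma ip_linr X Y Z (a : R) : ip Z (fun t => X t + a%:C *: Y t) = ip Z X + a * ip Z Y.
Proof. by rewrite ipC ip_lin !(ipC Z). Qed.

Lemma ip_ge0 X : 0 <= ip X X.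
Proof. by apply: sumr_ge0 => t _; exact: trip_ge0. Qed.

Lemma ip_le0_eq0 X t : ip X X <= 0 -> X t = 0.
Proof.
move=> X0; apply: trip_eq0.
have /psumr_eq0P h : ip X X = 0 by apply/eqP; rewrite eq_le X0 ip_ge0.
by apply: h => // *; exact: trip_ge0.
Qed.

Lemma total_powerE X : total_power X = ip X X.
Proof. by apply: eq_bigr => t _; rewrite tripxx. Qed.

Lemma total_power_line X Y (s : R) : total_power (fun t => X t + s%:C *: Y t) =
  total_power X + 2 * s * ip X Y + s ^+ 2 * ip Y Y.
Proof.
by rewrite !total_powerE ip_lin !ip_linr (ipC Y X); ring.
Qed.

(** In the interior every direction is feasible, so g itself may be tested and g = 0. On the sphere,
    only strictly inward directions are tested: -P gives theta >= 0, and inward tilts of the part of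
    g orthogonal to P show that this part vanishes. *)
Lemma kkt_of_first_order (P g : 'I_L -> 'M[C]_n) (Pw : R) : 0 < Pw -> total_power P <= Pw ->
  (forall D, (exists2 e : R, 0 < e & forall s, 0 < s < e ->
     total_power (fun t => P t + s%:C *: D t) <= Pw) -> ip D g <= 0) ->
  exists theta : R, [/\ forall t, g t = theta%:C *: P t,
    theta * (total_power P - Pw) = 0 & 0 <= theta].
Proof.
move=> Pw0; rewrite le_eqVlt => /orP[/eqP PE|Plt] first_order; last first.
  exists 0; split => [t||]; rewrite ?mul0r // scale0r.
  apply: ip_le0_eq0; apply: first_order.
  set a := ip P g; set b := ip g g; have b0 : 0 <= b by exact: ip_ge0.
  (* For s <= 1 the power grows by at most s (2|a| + b), so s K below the slack keeps the step
     feasible. *)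
  pose K := 2 * `|a| + b + 1; have a0 : 0 <= `|a| by [].
  have K0 : 0 < K by rewrite /K; lra.
  exists (Num.min 1 ((Pw - total_power P) / K)).
    by rewrite lt_min ltr01 divr_gt0 // subr_gt0.
  move=> s /andP[s0]; rewrite lt_min ltr_pdivlMr // => /andP[s1 sK].
  rewrite total_power_line -/a -/b.
  have : s ^+ 2 * b <= s * b by rewrite ler_wpM2r // expr2 ler_piMr // ltW.
  have : s * a <= s * `|a| by rewrite ler_wpM2l ?ler_norm // ltW.
  have : 0 <= s by rewrite ltW.
  by move: sK; rewrite /K !mulrDr; lra.
have descent D : ip P D < 0 -> ip D g <= 0.
  move=> PD; apply: first_order; have DD := ip_ge0 D.
  (* Feasibility amounts to 2 <P,D> + s <D,D> <= 0; the summand 1 covers <D,D> = 0. *)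
  exists (- 2 * ip P D / (ip D D + 1)); first by rewrite divr_gt0 //; lra.
  move=> s /andP[s0]; rewrite ltr_pdivlMr; last lra.
  move=> hs; rewrite total_power_line PE -addrA gerDl.
  have -> : 2 * s * ip P D + s ^+ 2 * ip D D = s * (2 * ip P D + s * ip D D) by ring.
  by rewrite pmulr_rle0 //; move: hs; rewrite mulrDr; lra.
have PP : 0 < ip P P by rewrite -total_powerE PE.
set theta := ip P g / ip P P.
have thetaE : theta * ip P P = ip P g by rewrite divfK // gt_eqF.
have g0 : 0 <= ip P g.
  pose D t := 0 + (- 1 : R)%:C *: P t.
  have DE Z : ip D Z = - ip P Z.
    by rewrite ip_lin mulN1r (_ : ip _ Z = 0) ?add0r // /ip big1 // => t _; rewrite /trip ctmx0 mul0mx mxtrace0.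
  have := descent D; rewrite ipC !DE oppr_lt0 oppr_le0; exact.
exists theta; split=> [t||]; last by rewrite divr_ge0 // ltW.
  pose E t := g t + (- theta)%:C *: P t.
  have EP : ip E P = 0 by rewrite ip_lin (ipC g) mulNr thetaE subrr.
  suff /(ip_le0_eq0 t)/eqP : ip E E <= 0.
    by rewrite /E rmorphN scaleNr subr_eq0 => /eqP.
  have EE : ip E E = ip E g.
    by rewrite {2}/E ip_linr EP mulr0 addr0.
  apply/ler_addgt0Pr => e e0; rewrite add0r.
  (* The tilt E - f P is strictly inward for every f > 0 and yields |E|^2 <= f <P,g>; this f makes
     the right side at most e. *)
  pose f := e / (ip P g + 1); have f0 : 0 < f by rewrite divr_gt0 //; lra.
  have fE : f * (ip P g + 1) = e by rewrite divfK // gt_eqF //; lra.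
  pose D t := E t + (- f)%:C *: P t.
  have PD : ip P D < 0 by rewrite ipC ip_lin EP add0r mulNr oppr_lt0 mulr_gt0.
  have := descent D PD; rewrite ip_lin -EE mulNr subr_le0 => /le_trans; apply.
  by rewrite -fE mulrDr mulr1 lerDl ltW.
by rewrite PE subrr mulr0.
Qed.
End KKT.

Lemma halve_quadratic (R : realType) (s x y : R) :
  2 * s * x - s ^+ 2 * y <= 0 -> x * s - 2^-1 * y * s ^+ 2 <= 0.
Proof. by move=> h; lra. Qed.

Lemma weighted_gain_le (R : realType) (m a c s g q y : R) :
  m * (2 * s * a - c * s ^+ 2) <= m * y ->
  2 * s * (m * a - g) - s ^+ 2 * (m * c + q) <= m * y - (2 * s * g + s ^+ 2 * q).
Proof. by move=> h; lra. Qed.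

(** * Stationarity of an optimal design *)

Section Optimality.
Context {R : realType} {d : measure_display} {T : measurableType d} (Pr : probability T R).
Local Notation C := R[i].
Variables (Nt Nr L : nat) (N0 Pw : R) (mu : 'I_L -> R) (H : 'I_L -> T -> 'M[C]_(Nr, Nt)).
Variables (F P : 'I_L -> 'M[C]_Nt).
Hypotheses (Nt_gt0 : (0 < Nt)%N) (N0_gt0 : 0 < N0) (mu_ge0 : forall l, 0 <= mu l).
Hypothesis H_random : forall l, random_matrix (H l).
Hypothesis H_power : forall l,
  (\int[Pr]_w (complex.Re (\tr (H l w *m ctmx (H l w))))%:E < +oo)%E.
Hypothesis FP_optimal : optimal Pr N0 Pw mu H F P.
Local Notation Sig := (covs P).
Let P_unit : forall l, P l \in unitmx. Proof. by case: FP_optimal => -[]. Qed.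

Definition Gbar t : 'M[C]_Nt :=
  \sum_l (mu l)%:C *: Emx Pr (fun w => Gsel N0 F P l t (H l w)).

(** The left side of (iii) divided by log2 e. In natural logarithms, the linear term of the lower
    bound along D is 2 s [ip D grad]. *)
Definition grad t : 'M[C]_Nt := (mu t)%:C *: invmx (ctmx (P t)) - Gbar t *m P t.

Let ln2V_gt0 : 0 < (ln 2 : R)^-1.
Proof. by rewrite invr_gt0 ln_gt0 // ltr1n. Qed.

Lemma Gbar_herm t : ctmx (Gbar t) = Gbar t.
Proof.
rewrite /Gbar ctmx_sum; apply: eq_bigr => l _; rewrite ctmxZ conjc_real; congr (_ *: _).
have dG := Gsel_dominated N0_gt0 H_random F P_unit l t.
apply: (ctmx_Emx (gauge_integrable H_random H_power l) dG) => w.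
exact: Gsel_herm.
Qed.

(** Exchanging the sum over receivers with the sum over perturbed covariances collects all the
    effects of covariance t in [Gbar t]. *)
Lemma WSR_ge_precoder P' : (forall t, P' t \in unitmx) ->
  WSR Pr N0 mu H F P + (ln 2)^-1 *
    \sum_t (mu t * (ln (complex.Re (\det (covs P' t))) - ln (complex.Re (\det (Sig t))))
            - complex.Re (\tr (Gbar t *m (covs P' t - Sig t))))
  <= WSR Pr N0 mu H F P'.
Proof.
move=> P'_unit; set a := fun t => ln (complex.Re (\det (covs P' t))) - ln (complex.Re (\det (Sig t))).
pose b l t := complex.Re (\tr (Emx Pr (fun w => Gsel N0 F P l t (H l w)) *m (covs P' t - Sig t))).
have GE t : complex.Re (\tr (Gbar t *m (covs P' t - Sig t))) = \sum_l mu l * b l t.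
  have trD : {morph (fun M : 'M[C]_Nt => complex.Re (\tr M)) : x y / x + y}.
    by move=> x y; rewrite mxtraceD ReD.
  have tr0 : complex.Re (\tr (0 : 'M[C]_Nt)) = 0 by rewrite mxtrace0.
  rewrite /Gbar mulmx_suml (big_morph _ trD tr0); apply: eq_bigr => l _.
  by rewrite -scalemxAl mxtraceZ ReZ.
have -> : (ln 2)^-1 * \sum_t (mu t * a t - complex.Re (\tr (Gbar t *m (covs P' t - Sig t))))
    = \sum_l mu l * ((ln 2)^-1 * (a l - \sum_t b l t)).
  under eq_bigr do rewrite GE.
  rewrite sumrB exchange_big /= -sumrB mulr_sumr; apply: eq_bigr => l _.
  by rewrite -mulr_sumr -mulrBr mulrCA.
rewrite /WSR /wsum_rate -big_split /=; apply: ler_sum => l _; rewrite -mulrDr ler_wpM2l //.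
exact: (rate_ge_precoder N0_gt0 H_random H_power F P_unit l P'_unit).
Qed.

Lemma gradient_le0 D : (exists2 e : R, 0 < e & forall s, 0 < s < e ->
    total_power (fun t => P t + s%:C *: D t) <= Pw) -> ip D grad <= 0.
Proof.
move=> [e e0 he].
have /choice[cs /choice[es hes]] t := ln_det_gram_ge (D t) Nt_gt0 (P_unit t).
(* A positive lower bound of [e] and of all [es t], in place of a finite minimum. *)
pose e' := (e^-1 + \sum_t (es t)^-1)^-1.
have es0 t : 0 < es t by case: (hes t).
have sum0 : 0 <= \sum_t (es t)^-1 by apply: sumr_ge0 => t _; rewrite invr_ge0 ltW.
have e'0 : 0 < e' by rewrite invr_gt0 ltr_wpDr // invr_gt0.
have e'e : e' <= e by rewrite -[e]invrK lef_pV2 ?posrE ?invr_gt0 ?ltr_wpDr ?lerDl // invr_gt0.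
have e'es t : e' <= es t.
  rewrite -[es t]invrK lef_pV2 ?posrE ?invr_gt0 //; last by rewrite ltr_wpDr // invr_gt0.
  rewrite (bigD1 t) //= addrCA lerDl; apply: addr_ge0; first by rewrite invr_ge0 ltW.
  by apply: sumr_ge0 => k _; rewrite invr_ge0 ltW.
pose q t := complex.Re (\tr (Gbar t *m (D t *m ctmx (D t)))).
apply: (@le0_of_quadratic R (ip D grad) (2^-1 * \sum_t (mu t * cs t + q t)) e' e'0) => s /andP[s0 se].
pose P' t := P t + s%:C *: D t.
have hP' t : P' t \in unitmx /\ 2 * s * trip (D t) (invmx (ctmx (P t))) - cs t * s ^+ 2 <=
    ln (complex.Re (\det (covs P' t))) - ln (complex.Re (\det (Sig t))).
  by have [_] := hes t; apply; rewrite s0 (lt_le_trans se).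
have feas : feasible Pw P'.
  by split=> [t|]; [case: (hP' t)|apply: he; rewrite s0 (lt_le_trans se)].
have opt := FP_optimal.2 F P' feas.
have := le_trans (WSR_ge_precoder (fun t => (hP' t).1)) opt.
rewrite gerDl pmulr_rle0 // => hsum.
suff : \sum_t (2 * s * trip (D t) (grad t) - s ^+ 2 * (mu t * cs t + q t)) <= 0.
  by rewrite sumrB -!mulr_sumr => /halve_quadratic.
apply: le_trans hsum; apply: ler_sum => t _.
have quad : complex.Re (\tr (Gbar t *m (covs P' t - Sig t))) =
    2 * s * trip (D t) (Gbar t *m P t) + s ^+ 2 * q t.
  have -> : covs P' t - Sig t = s%:C *: (D t *m ctmx (P t)) + s%:C *: (P t *m ctmx (D t))
      + (s ^+ 2)%:C *: (D t *m ctmx (D t)).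
    rewrite /covs /P' ctmxD ctmxZ conjc_real !mulmxDl !mulmxDr.
    by rewrite -?scalemxAl -?scalemxAr -?scalemxAl -?scalemxAr rmorphXn /=; mx_entrywise.
  rewrite Re_tr_quadratic -/(q t).
  have -> : complex.Re (\tr (Gbar t *m (P t *m ctmx (D t)))) = trip (D t) (Gbar t *m P t).
    by rewrite /trip mulmxA mxtrace_mulC.
  have -> : complex.Re (\tr (Gbar t *m (D t *m ctmx (P t)))) = trip (D t) (Gbar t *m P t).
    by rewrite tripC /trip ctmxM Gbar_herm mulmxA [in LHS]mxtrace_mulC mulmxA.
  by ring.
rewrite quad /grad tripDr tripNr tripZr.
by apply: weighted_gain_le; exact: (ler_wpM2l (mu_ge0 t) (hP' t).2).
Qed.

(** The power does not involve F, so the direction -Phi is admissible and would gain 2 s |Phi|^2 to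
    first order. A zero weight carries no information on Phi, but then the weighted expression
    vanishes. *)
Lemma inflation_stationary l :
  (mu l)%:C *: Emx Pr (fun w => invmx (SigU N0 F Sig l (H l w))
                 *m (F l - Tmx N0 F Sig l (H l w)) *m SigS Sig l) = 0.
Proof.
set Phi := Emx _ _.
have [->|mul0] := eqVneq (mu l) 0; first by rewrite scale0r.
have mul_gt0 : 0 < mu l by rewrite lt_neqAle eq_sym mul0 mu_ge0.
suff -> : Phi = 0 by rewrite scaler0.
apply: trip_eq0; apply/eqP; rewrite eq_le trip_ge0 andbT.
pose D := - Phi.
pose q := complex.Re (\tr (Emx Pr (fun w => invmx (SigU N0 F Sig l (H l w)))
                       *m (D *m SigS Sig l *m ctmx D))).
apply: (@le0_of_quadratic R _ (2^-1 * q) 1 ltr01) => s /andP[s0 _].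
pose F' t := if t == l then F l + s%:C *: D else F t.
have opt := FP_optimal.2 F' P FP_optimal.1.
suff : WSR Pr N0 mu H F P - mu l * ((ln 2)^-1 * (2 * s * trip D Phi + s ^+ 2 * q))
    <= WSR Pr N0 mu H F' P.
  move=> /le_trans/(_ opt); rewrite gerBl pmulr_rge0 // pmulr_rge0 // /D tripNl mulrN addrC subr_ge0 -subr_le0.
  exact: halve_quadratic.
set x := (ln 2)^-1 * _.
have -> : mu l * x = \sum_t mu t * (if t == l then x else 0).
  by rewrite (bigD1 l) //= eqxx big1 ?addr0 // => t /negbTE ->; rewrite mulr0.
rewrite /WSR /wsum_rate -sumrB; apply: ler_sum => t _; rewrite -mulrBr.
apply: ler_wpM2l; first exact: mu_ge0.
have := @rate_ge_inflation _ _ _ Pr _ _ _ _ H N0_gt0 H_random H_power F P P_unit F'.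
have [->|tl] := eqVneq t l; first by move=> /(_ D s l); apply; rewrite /F' eqxx.
(* For the other receivers the bound is used with a zero direction and step, where it gives no
   loss. *)
move=> /(_ 0 0 t); rewrite expr0n mulr0 !mul0r addr0 mulr0; apply.
by rewrite /F' (negbTE tl) scaler0 addr0.
Qed.

Lemma GbarE t : Gbar t =
  \sum_(l < L | (l < t)%N) (mu l)%:C *: Emx Pr (fun w => G1 N0 F Sig l (H l w))
  + (mu t)%:C *: Emx Pr (fun w => G2 N0 F Sig t (H t w))
  + \sum_(l < L | (t < l)%N) (mu l)%:C *: Emx Pr (fun w => G3 N0 F Sig l (H l w)).
Proof.
apply: etrans (sum_split3 t _) _; apply: f_equal2; first apply: f_equal2.
- apply: eq_bigr => l lt; congr (_ *: Emx _ _); apply/funext => w.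
  by rewrite GselE ltnNge (ltnW lt) /= -val_eqE gtn_eqF.
- by congr (_ *: Emx _ _); apply/funext => w; rewrite GselE ltnn eqxx.
- by apply: eq_bigr => l lt; congr (_ *: Emx _ _); apply/funext => w; rewrite GselE lt.
Qed.

End Optimality.
Theorem theorem1 (R : realType) (d : measure_display) (T : measurableType d)
  (Pr : probability T R) (Nt Nr L : nat) (N0 Pw : R) (mu : 'I_L -> R)
  (H : 'I_L -> T -> 'M[R[i]]_(Nr, Nt)) (F P : 'I_L -> 'M[R[i]]_Nt) :
  (0 < Nt)%N -> (0 < Nr)%N -> (0 < L)%N ->
  0 < N0 -> 0 < Pw ->
  (forall l, 0 <= mu l) -> \sum_(l < L) mu l = L%:R ->
  (forall l, random_matrix (H l)) ->
  mutually_independent Pr H ->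
  (forall l, (\int[Pr]_w (complex.Re (\tr (H l w *m ctmx (H l w))))%:E < +oo)%E) ->
  optimal Pr N0 Pw mu H F P ->
  let Sig := covs P in
  let log2e := log2 (expR 1) in
  exists theta : R,
    (* (i) *)
    (forall l : 'I_L,
       (- (mu l * log2e))%:C *:
         Emx Pr (fun w => invmx (SigU N0 F Sig l (H l w))
                          *m (F l - Tmx N0 F Sig l (H l w)) *m SigS Sig l) = 0)
    (* (ii) *)
    /\ (forall l : 'I_L, Sig l = P l *m ctmx (P l))
    (* (iii) *)
    /\ (forall t : 'I_L,
         (mu t * log2e)%:C *: invmx (ctmx (P t))
         - log2e%:C *:
             (\sum_(l < L | (l < t)%N) (mu l)%:C *: Emx Pr (fun w => G1 N0 F Sig l (H l w))
              + (mu t)%:C *: Emx Pr (fun w => G2 N0 F Sig t (H t w))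
              + \sum_(l < L | (t < l)%N) (mu l)%:C *: Emx Pr (fun w => G3 N0 F Sig l (H l w)))
           *m P t
         = theta%:C *: P t)
    (* (iv) *)
    /\ theta * (total_power P - Pw) = 0
    (* (v) *)
    /\ total_power P - Pw <= 0
    (* (vi) *)
    /\ 0 <= theta.

Proof.
move=> Nt0 _ _ N00 Pw0 mu0 _ H_random _ H_power opt Sig log2e.
have log2eE : log2e = (ln 2)^-1 by rewrite /log2e /log2 expRK mul1r.
have log2e0 : 0 <= log2e by rewrite log2eE invr_ge0 ln_ge0 // ler1n.
have [theta [gE slack theta0]] := kkt_of_first_order Pw0 opt.1.2
  (gradient_le0 Nt0 N00 mu0 H_random H_power opt).
(* [grad] is expressed in natural logarithms; the factor [log2e], equal to 1 / ln 2, converts the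
   multiplier to base 2. *)
exists (log2e * theta); split.
  move=> l; rewrite -mulrN [mu l * _]mulrC rmorphM -scalerA.
  by rewrite [X in _ *: X](inflation_stationary N00 mu0 H_random H_power opt l) scaler0.
split=> //; split.
  move=> t; rewrite -GbarE -scalemxAl [(mu t * _)%:C]rmorphM [_%:C * _]mulrC -scalerA -scalerBr.
  by rewrite -/(grad Pr N0 mu H F P t) gE scalerA -rmorphM.
split; first by rewrite -mulrA slack mulr0.
by split; [rewrite subr_le0; exact: opt.1.2|rewrite mulr_ge0].
Qed.
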